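(* Let $W$ be a standard real-valued Brownian motion and $Y_{s,t}=(W_{s,t},H_{s,t},K_{s,t})^T$, where $H$ and $K$ are the space-time and space-time-time Lévy areas of $W$. For any $0\le s<u$ and $r\in[s,u]$, the distribution of $Y_{s,r}$ conditioned on $Y_{s,u}$ is Gaussian with mean $$\mathbb{E}[W_{s,r}\mid Y_{s,u}]=\frac{r-s}{u-s}W_{s,u}+6\,\frac{(r-s)(u-r)}{(u-s)^2}H_{s,u}+120\,\frac{(r-s)(u-r)\left(\frac12(u+s)-r\right)}{(u-s)^3}K_{s,u},$$ $$\mathbb{E}[H_{s,r}\mid Y_{s,u}]=\frac{(r-s)^2}{(u-s)^2}H_{s,u}+30\,\frac{(r-s)^2(u-r)}{(u-s)^3}K_{s,u},\qquad \mathbb{E}[K_{s,r}\mid Y_{s,u}]=\frac{(r-s)^3}{(u-s)^3}K_{s,u},$$ and covariance matrix $$\Sigma_r:=\mathbb{E}\Big[\big(Y_{s,r}-\mathbb{E}[Y_{s,r}|Y_{s,u}]\big)\big(Y_{s,r}-\mathbb{E}[Y_{s,r}|Y_{s,u}]\big)^T\,\Big|\,Y_{s,u}\Big]=\begin{bmatrix}\Sigma^{WW}_r&\Sigma^{WH}_r&\Sigma^{WK}_r\\ \Sigma^{WH}_r&\Sigma^{HH}_r&\Sigma^{HK}_r\\ \Sigma^{WK}_r&\Sigma^{HK}_r&\Sigma^{KK}_r\end{bmatrix}$$ with $$\Sigma^{WW}_r=\frac{(r-s)(u-r)\left((2r-u-s)^4+4(r-s)^2(u-r)^2\right)}{(u-s)^5},$$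 $$\Sigma^{WH}_r=-\frac{(r-s)^3(u-r)\left((r-s)^2-3(r-s)(u-r)+6(u-r)^2\right)}{2(u-s)^5},$$ $$\Sigma^{WK}_r=\frac{(r-s)^4(u-r)(2r-u-s)}{12(u-s)^5},$$ $$\Sigma^{HH}_r=\frac{r-s}{12}\left(1-\frac{(r-s)^3\left((r-s)^2+2(r-s)(u-r)+16(u-r)^2\right)}{(u-s)^5}\right),$$ $$\Sigma^{HK}_r=-\frac{(r-s)^5(u-r)}{24(u-s)^5},\qquad \Sigma^{KK}_r=\frac{r-s}{720}\left(1-\frac{(r-s)^5}{(u-s)^5}\right).$$
   Context: For a Brownian motion $W$ and $0\le s<t$: $W_{s,t}=W_t-W_s$; the Brownian bridge is $B_q^{s,t}=W_{s,q}-\frac{q-s}{t-s}W_{s,t}$ for $q\in[s,t]$ (with $B_s^{s,s}=0$); the space-time Lévy area is $H_{s,t}=\frac1{t-s}\int_s^tB_q^{s,t}\,dq$; the space-time-time Lévy area is $K_{s,t}=\frac1{(t-s)^2}\int_s^tB_q^{s,t}\left(\frac{t+s}2-q\right)dq$. By convention $H_{s,s}=K_{s,s}=0$. Gaussian distributions may be degenerate. *)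

(* Defs.v *)
From HB Require Import structures.
From mathcomp Require Import all_boot all_order all_algebra.
From mathcomp Require Import all_classical all_reals all_analysis.

Set Implicit Arguments.
Unset Strict Implicit.
Unset Printing Implicit Defensive.

Import Order.TTheory GRing.Theory Num.Theory.
Import numFieldNormedType.Exports.

Local Open Scope classical_set_scope.
Local Open Scope ring_scope.

Section Brownian.
Context {R : realType} {d : measure_display} {T : measurableType d}.
Variables (P : probability T R).

(* Taking some of the [B i] equal to [setT] yields the product rule for every
   subfamily. *)
Definition mutually_independent (n : nat) (X : 'I_n -> T -> R) : Prop :=
  forall B : 'I_n -> set R, (forall i, measurable (B i)) ->
    P (\bigcap_(i in [set: 'I_n]) (X i @^-1` B i)) =
    (\prod_(i < n) P (X i @^-1` B i))%E.

(* The time index is real, but only the values at nonnegative times are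
   constrained. *)
Record standard_brownian (W : R -> T -> R) : Prop := StandardBrownian {
  bm_measurable : forall t : R, 0 <= t -> measurable_fun [set: T] (W t) ;
  bm_start : {ae P, forall w, W 0 w = 0} ;
  bm_continuous : forall w, {within `[0, +oo[, continuous (fun t => W t w)} ;
  bm_independent : forall (n : nat) (t : nat -> R),
    0 <= t 0%N -> nondecreasing_seq t ->
    mutually_independent (fun i : 'I_n => W (t i.+1) \- W (t i)) ;
  bm_normal : forall s t : R, 0 <= s -> s < t ->
    forall B : set R, measurable B ->
      P ((W t \- W s) @^-1` B) = normal_prob 0 (Num.sqrt (t - s)) B }.

(* [X] has a conditional distribution given [Y], and [k] is a regular version
   of it. *)
Definition cond_distribution d1 d2 (E : measurableType d1)
    (F : measurableType d2) (X : T -> E) (Y : T -> F) (k : R.-pker F ~> E) :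
    Prop :=
  [/\ measurable_fun [set: T] X, measurable_fun [set: T] Y &
   forall (A : set E) (B : set F), measurable A -> measurable B ->
     P (X @^-1` A `&` Y @^-1` B) =
     (\int[P]_(w in Y @^-1` B) k (Y w) A)%E].

(* [Z] is a version of the conditional expectation of [X] given the
   sigma-algebra generated by [Y]. *)
Definition cond_expectation d2 (F : measurableType d2) (Y : T -> F)
    (X Z : T -> R) : Prop :=
  [/\ P.-integrable [set: T] (EFin \o X),
      P.-integrable [set: T] (EFin \o Z),
      (forall B : set R, measurable B ->
         g_sigma_algebra_preimage Y (Z @^-1` B)) &
      forall A : set T, g_sigma_algebra_preimage Y A ->
        (\int[P]_(w in A) (Z w)%:E = \int[P]_(w in A) (X w)%:E)%E].

End Brownian.

Section Gaussian.
Context {R : realType}.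

(* [normal_prob m 0] is not the Dirac mass at [m] (it is the uniform law on
   [0, 1]), so the degenerate case is separated. *)
Definition gaussian1 (m sigma : R) (B : set R) : \bar R :=
  if sigma == 0 then \d_m B else normal_prob m sigma B.

Variables (n : nat) (mu : {measure set (n.-tuple R) -> \bar R}).

Definition is_gaussian : Prop :=
  forall a : 'I_n -> R, exists m sigma : R,
    forall B : set R, measurable B ->
      mu [set x | B (\sum_(i < n) a i * tnth x i)] = gaussian1 m sigma B.

Definition has_mean (m : n.-tuple R) : Prop :=
  forall i : 'I_n,
    mu.-integrable [set: n.-tuple R] (fun x => (tnth x i)%:E) /\
    (\int[mu]_x (tnth x i)%:E = (tnth m i)%:E)%E.

Definition has_covariance (m : n.-tuple R) (S : 'M[R]_n) : Prop :=
  forall i j : 'I_n,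
    mu.-integrable [set: n.-tuple R]
      (fun x => ((tnth x i - tnth m i) * (tnth x j - tnth m j))%:E) /\
    (\int[mu]_x ((tnth x i - tnth m i) * (tnth x j - tnth m j))%:E =
       (S i j)%:E)%E.

Definition gaussian_law (m : n.-tuple R) (S : 'M[R]_n) : Prop :=
  [/\ is_gaussian, has_mean m & has_covariance m S].

End Gaussian.

Section LevyAreas.
Context {R : realType} {T : Type}.
Variable W : R -> T -> R.

(* As [x / 0 = 0], the areas below vanish for [s = t], as does the bridge
   at [q = s = t]. *)
Definition bridge (s t q : R) (w : T) : R :=
  (W q w - W s w) - (q - s) / (t - s) * (W t w - W s w).

Definition space_time_area (s t : R) (w : T) : R :=
  (t - s)^-1 * \int[lebesgue_measure]_(q in `[s, t]) bridge s t q w.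

Definition space_time_time_area (s t : R) (w : T) : R :=
  (t - s) ^- 2 *
  \int[lebesgue_measure]_(q in `[s, t]) (bridge s t q w * ((t + s) / 2 - q)).

Definition levy_triple (s t : R) (w : T) : 3.-tuple R :=
  [tuple W t w - W s w; space_time_area s t w; space_time_time_area s t w].

End LevyAreas.

Section Formulas.
Context {R : realType}.
Variables s r u : R.

Definition mean_triple (y : 3.-tuple R) : 3.-tuple R :=
  [tuple
     (r - s) / (u - s) * y`_0
       + 6 * ((r - s) * (u - r) / (u - s) ^+ 2) * y`_1
       + 120 * ((r - s) * (u - r) * ((u + s) / 2 - r) / (u - s) ^+ 3) * y`_2;
     (r - s) ^+ 2 / (u - s) ^+ 2 * y`_1
       + 30 * ((r - s) ^+ 2 * (u - r) / (u - s) ^+ 3) * y`_2;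
     (r - s) ^+ 3 / (u - s) ^+ 3 * y`_2].

Definition SigmaWW : R :=
  (r - s) * (u - r)
    * ((2 * r - u - s) ^+ 4 + 4 * (r - s) ^+ 2 * (u - r) ^+ 2)
  / (u - s) ^+ 5.

Definition SigmaWH : R :=
  - ((r - s) ^+ 3 * (u - r)
       * ((r - s) ^+ 2 - 3 * (r - s) * (u - r) + 6 * (u - r) ^+ 2)
     / (2 * (u - s) ^+ 5)).

Definition SigmaWK : R :=
  (r - s) ^+ 4 * (u - r) * (2 * r - u - s) / (12 * (u - s) ^+ 5).

Definition SigmaHH : R :=
  (r - s) / 12 *
  (1 - (r - s) ^+ 3
         * ((r - s) ^+ 2 + 2 * (r - s) * (u - r) + 16 * (u - r) ^+ 2)
       / (u - s) ^+ 5).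

Definition SigmaHK : R := - ((r - s) ^+ 5 * (u - r) / (24 * (u - s) ^+ 5)).

Definition SigmaKK : R :=
  (r - s) / 720 * (1 - (r - s) ^+ 5 / (u - s) ^+ 5).

Definition Sigma : 'M[R]_3 :=
  \matrix_(i < 3, j < 3)
    tnth (tnth [tuple [tuple SigmaWW; SigmaWH; SigmaWK];
                      [tuple SigmaWH; SigmaHH; SigmaHK];
                      [tuple SigmaWK; SigmaHK; SigmaKK]] i) j.

End Formulas.

(* Main.v *)
(* Let Z = Y_{s,r} - E[Y_{s,r} | Y_{s,u}], with the conditional mean given by the
   stated linear formula. It suffices to show that Z is centred Gaussian with
   covariance Sigma and independent of Y_{s,u}: the conditional law of Y_{s,r}
   given Y_{s,u} = y is then the law of mean(y) + Z.

   Everything is read off the real Fourier transforms E cos (X + p), p in R. On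
   an interval of length h, a W + b H + c K is the Wiener integral of a quadratic
   polynomial, that is, a limit of linear combinations of independent Brownian
   increments, so E cos (a W + b H + c K + p) = cos p exp (- h (a^2 + b^2 / 12 +
   c^2 / 720) / 2), and the areas of [s, r] and [r, u] are independent. As
   Y_{s,u} is a linear function of Y_{s,r} and Y_{r,u}, the transform of
   x . Z + y . Y_{s,u} is the exponential of a quadratic form, and this form
   splits as a form in x (given by Sigma) plus a form in y.

   The transform determines the law without Fourier inversion: indicators of
   orthants are iterated bounded limits of trigonometric polynomials, since
   sgn x = lim_m sgn (sin (x / m)) and sgn is a limit of polynomials on
   [-1, 1]. *)

Require Import Defs.
From HB Require Import structures.
From mathcomp Require Import all_boot all_order all_algebra.
From mathcomp Require Import all_classical all_reals all_analysis.
From mathcomp Require Import measurable_realfun ring lra.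

Import Order.TTheory GRing.Theory Num.Theory.
Import numFieldNormedType.Exports.

Local Open Scope classical_set_scope.
Local Open Scope ring_scope.

(** * Trigonometric polynomials and indicators of orthants *)

(** The coefficients of the mean are regression coefficients. The coordinates of Y_{s,u} are
    uncorrelated with variances h, h / 12, h / 720 for h = u - s, so each coefficient is a
    covariance divided by one of these: Cov(W_{s,r}, H_{s,u}) = (r - s)(u - r) / (2 h) gives the 6,
    and 120 arises in the same way from 720. The kernels of W, H, K have degrees 0, 1, 2 and are
    orthogonal on their interval, which is why H_{s,r} sees no W_{s,u}, and K_{s,r} sees only
    K_{s,u}. Densities are avoided because the laws degenerate: for r = s or r = u the matrix Sigma
    vanishes. Translating an independent residual covers these cases uniformly. The phase p replaces
    complex exponentials: p = - pi / 2 turns a cosine into a sine, so a family of real integrals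
    carries the whole characteristic function, and a product of two cosines is again a sum of such
    terms. The transform only integrates bounded functions, whereas means and covariances do not;
    second moments are therefore recovered by a truncation through the sine. *)

Section DominatedConvergence.
Context {R : realType} {d : measure_display} {T : measurableType d}.
Variable mu : {measure set T -> \bar R}.

Lemma cvg_Rintegral (D : set T) (f_ : nat -> T -> R) (f g : T -> R) :
  measurable D ->
  (forall n, measurable_fun D (f_ n)) -> mu.-integrable D (EFin \o g) ->
  (forall x, D x -> f_ ^~ x @ \oo --> f x) ->
  (forall n x, D x -> `|f_ n x| <= g x) ->
  mu.-integrable D (EFin \o f) /\
  \int[mu]_(x in D) f_ n x @[n --> \oo] --> \int[mu]_(x in D) f x.
Proof.
move=> mD mf_ ig ff fg.
have mf : measurable_fun D f by apply: (measurable_fun_cvg mf_).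
have [|||||fi _ h] := @dominated_convergence _ _ _ mu D mD
  (fun n => EFin \o f_ n) (EFin \o f) (EFin \o g).
- by move=> n; exact/measurable_EFinP.
- exact/measurable_EFinP.
- by apply: aeW => x Dx; apply: cvg_EFin; [exact: nearW|exact: ff].
- exact: ig.
- by apply: aeW => x n Dx; rewrite lee_fin; exact: fg.
split => //; apply: fine_cvg.
rewrite fineK//; exact: integrable_fin_num.
Qed.

End DominatedConvergence.

Section BoundedFunctions.
Context {R : realType} {d : measure_display} {T : measurableType d}.

Definition bounded_measurable (f : T -> R) : Prop :=
  measurable_fun [set: T] f /\ exists M, forall x, `|f x| <= M.

Lemma bounded_measurableD (f g : T -> R) :
  bounded_measurable f -> bounded_measurable g -> bounded_measurable (f \+ g).
Proof.
move=> [mf [M fM]] [mg [N gN]]; split; first exact: measurable_funD.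
exists (M + N) => x; rewrite (le_trans (ler_normD _ _))//.
by rewrite lerD.
Qed.

Lemma bounded_measurableM (f g : T -> R) :
  bounded_measurable f -> bounded_measurable g -> bounded_measurable (f \* g).
Proof.
move=> [mf [M fM]] [mg [N gN]]; split; first exact: measurable_funM.
by exists (M * N) => x; rewrite /= normrM ler_pM.
Qed.

Lemma bounded_measurable_cst (c : R) : bounded_measurable (cst c).
Proof. by split => //; exists `|c|. Qed.

Lemma bounded_measurable_cos (f : T -> R) :
  measurable_fun [set: T] f -> bounded_measurable (fun x => cos (f x)).
Proof.
move=> mf; split; last first.
  by exists 1 => x; rewrite ler_norml cos_geN1 cos_le1.
by apply: (measurableT_comp _ mf); apply: continuous_measurable_fun;
  exact: continuous_cos.
Qed.

Lemma bounded_measurable_sin (f : T -> R) :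
  measurable_fun [set: T] f -> bounded_measurable (fun x => sin (f x)).
Proof.
move=> mf; split; last first.
  by exists 1 => x; rewrite ler_norml sin_geN1 sin_le1.
by apply: (measurableT_comp _ mf); apply: continuous_measurable_fun;
  exact: continuous_sin.
Qed.

Lemma bounded_measurable_integrable
    (mu : {finite_measure set T -> \bar R}) (f : T -> R) :
  bounded_measurable f -> mu.-integrable [set: T] (EFin \o f).
Proof.
move=> [mf [M fM]]; apply: measurable_bounded_integrable => //.
  by rewrite -ge0_fin_numE// fin_num_measure.
by exists M; split; [exact: num_real|] => N MN x _ /=; rewrite (le_trans (fM x))// ltW.
Qed.

End BoundedFunctions.

Section TrigonometricClosure.
Context {R : realType}.

(** The odd cubic fixing -1, 0 and 1 with zero slope at -1 and 1. Its slope 3 / 2 at 0 repels, so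
    iteration drives every nonzero point of [-1, 1] to its sign. *)
Let halfcube (s : R) : R := s * (3 - s ^+ 2) / 2.

Let halfcube_iter_norm_le1 (k : nat) (s : R) : `|s| <= 1 ->
  `|iter k halfcube s| <= 1.
Proof.
move=> s1; elim: k => //= k; set y := iter _ _ _ => y1.
move: y1; rewrite !ler_norml /halfcube => /andP[ym yM].
apply/andP; split.
  (* Twice the distance to the endpoint: [1 + halfcube y] is (1 + y)^2 (2 - y) / 2, and
     symmetrically [1 - halfcube y] is (1 - y)^2 (2 + y) / 2. *)
  have : 0 <= (1 + y) ^+ 2 * (2 - y) by rewrite mulr_ge0 ?sqr_ge0//; lra.
  by nra.
have : 0 <= (1 - y) ^+ 2 * (2 + y) by rewrite mulr_ge0 ?sqr_ge0//; lra.
by nra.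
Qed.

(** One step multiplies the gap 1 - y by (1 - y)(2 + y) / 2 = 1 - y / 2 - y^2 / 2. The iterates
    never fall below the starting point [s], so this factor is at most 1 - s / 2 and the decay is
    geometric. *)
Let halfcube_iter_lt (s : R) (k : nat) : 0 < s <= 1 ->
  s <= iter k halfcube s <= 1 /\
  1 - iter k halfcube s <= (1 - s / 2) ^+ k.
Proof.
move=> /andP[s0 s1]; elim: k => [|k [/andP[IH1 IH2] IH3]].
  by rewrite /= lexx s1 expr0; split => //; lra.
rewrite iterS; move: IH1 IH2 IH3; set y := iter _ _ _ => sy y1 IH.
have hy : 0 <= (1 - y) * (1 - s / 2 - (1 - y) * (2 + y) / 2).
  rewrite mulr_ge0//; first lra.
  have : 0 <= y * y by nra.
  by lra.
have e : 1 - halfcube y = (1 - y) * ((1 - y) * (2 + y) / 2).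
  by rewrite /halfcube; field.
have e2 : halfcube y - y = y * (1 - y) * (1 + y) / 2.
  by rewrite /halfcube; field.
have e3 : 0 <= y * (1 - y) * (1 + y) by rewrite !mulr_ge0//; lra.
have e4 : 0 <= (1 - y) * ((1 - y) * (2 + y) / 2).
  by rewrite !mulr_ge0// ?invr_ge0//; lra.
split; first by apply/andP; split; lra.
rewrite e exprSr.
have : (1 - y) * (1 - s / 2) <= (1 - s / 2) ^+ k * (1 - s / 2).
  by rewrite ler_wpM2r//; lra.
lra.
Qed.

Let halfcube_iterN k s : iter k halfcube (- s) = - iter k halfcube s.
Proof.
by elim: k => //= k ->; rewrite /halfcube sqrrN !mulNr.
Qed.

Let cvg_halfcube_iter (s : R) : `|s| <= 1 ->
  iter k halfcube s @[k --> \oo] --> Num.sg s.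
Proof.
wlog s0 : s / 0 <= s => [hwlog|] s1.
  have [/hwlog|s0] := leP 0 s; first exact.
  have -> : (fun k => iter k halfcube s) =
    (fun k => - iter k halfcube (- s)).
    by apply/funext => k; rewrite halfcube_iterN opprK.
  rewrite -[s in Num.sg s]opprK sgrN; apply: cvgN.
  by apply: hwlog; rewrite ?normrN//; lra.
move: s0; rewrite le_eqVlt => /predU1P[<-|s0].
  rewrite sgr0 (_ : (fun k => _) = cst 0); first exact: cvg_cst.
  by apply/funext => k /=; elim: k => //= k ->; rewrite /halfcube !mul0r.
rewrite gtr0_sg//.
have {}s1 : 0 < s <= 1 by rewrite s0 (le_trans _ s1)// ler_norm.
have hk k := halfcube_iter_lt s k s1.
apply: (@squeeze_cvgr _ _ _ _ (fun k => 1 - (1 - s / 2) ^+ k) (cst 1)).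
- by apply: nearW => k; have [/andP[_ ->]] := hk k; rewrite andbT /=; lra.
- rewrite -[X in _ --> X]subr0; apply: cvgB; first exact: cvg_cst.
  by apply: cvg_expr; rewrite ger0_norm; lra.
- exact: cvg_cst.
Qed.

(** Sends the sign values -1, 0, 1 to 0, 0, 1: a polynomial turning a sign into the indicator of a
    strict inequality. *)
Let step (s : R) : R := (s + s ^+ 2) / 2.

Let step_sg (s : R) : step (Num.sg s) = (0 < s)%R%:R.
Proof.
rewrite /step; have [s0|s0|->] := ltrgt0P s.
- by rewrite gtr0_sg// expr1n -mulr2n -(mulr_natl 1) mulr1 divff.
- by rewrite ltr0_sg// sqrrN expr1n addNr mul0r.
- by rewrite sgr0 expr0n /= addr0 mul0r.
Qed.

Let step_norm_le1 (s : R) : `|s| <= 1 -> `|step s| <= 1.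
Proof. by rewrite /step !ler_norml => /andP[? ?]; apply/andP; split; nra. Qed.

Let cvg_step {F : set_system nat} {FF : Filter F} (u : nat -> R) (l : R) :
  u @ F --> l -> (step \o u) @ F --> step l.
Proof.
move=> ul; apply: cvgM; last exact: cvg_cst.
by apply: cvgD => //; rewrite expr2; apply: cvgM.
Qed.

Lemma norm_sin_le (x : R) : `|sin x| <= `|x|.
Proof.
wlog x0 : x / 0 <= x => [hwlog|].
  have [/hwlog//|x0] := leP 0 x.
  by rewrite -normrN -sinN -(normrN x); apply: hwlog; lra.
have [->|xn0] := eqVneq x 0; first by rewrite sin0 normr0.
have xgt0 : 0 < x by rewrite lt_neqAle eq_sym xn0.
have [] := @MVT _ sin cos 0 x xgt0 (fun y _ => is_derive_sin y).
  by apply: continuous_subspaceT; exact: continuous_sin.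
move=> c _; rewrite sin0 !subr0 => ->; rewrite normrM ler_piMl// ler_norml.
by rewrite cos_geN1 cos_le1.
Qed.

Lemma cvg_harmonic_mul (x : R) : x / n.+1%:R @[n --> \oo] --> (0 : R).
Proof.
by rewrite -(mulr0 x); apply: cvgM; [exact: cvg_cst|exact: cvg_harmonic].
Qed.

(** The sequence is eventually constant: once |x| / (n + 1) is below pi, the sine has the sign of
    its argument. *)
Let cvg_sg_sin (x : R) : Num.sg (sin (x / n.+1%:R)) @[n --> \oo] --> Num.sg x.
Proof.
wlog x0 : x / 0 <= x => [hwlog|].
  have [/hwlog//|x0] := leP 0 x.
  rewrite -(opprK x) sgrN (_ : (fun n => _) =
    fun n : nat => - Num.sg (sin (- x / n.+1%:R))); last first.
    by apply/funext => n; rewrite !mulNr !sinN !sgrN.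
  by apply: cvgN; apply: hwlog; lra.
have [->|xn0] := eqVneq x 0.
  rewrite (_ : (fun n => _) = cst (Num.sg 0)); first exact: cvg_cst.
  by apply/funext => n /=; rewrite mul0r sin0.
have xgt0 : 0 < x by rewrite lt_neqAle eq_sym xn0.
rewrite gtr0_sg//; apply: cvg_near_cst.
have : \forall n \near \oo, x / n.+1%:R < pi.
  exact: (cvgr_lt (0 : R) (cvg_harmonic_mul x) _ (pi_gt0 _)).
apply: filterS => n xn; rewrite gtr0_sg// sin_gt0_pi// xn andbT.
by rewrite divr_gt0.
Qed.

Section Family.
Context {T : Type} {n : nat} (X : 'I_n -> T -> R).

(** The phase lets a single constructor produce cosines, sines and constants. Products need no
    constructor: they follow from cos x cos y = (cos (x + y) + cos (x - y)) / 2. *)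
Inductive trig_poly : (T -> R) -> Prop :=
| trig_poly_cos (a : 'I_n -> R) (p : R) :
    trig_poly (fun w => cos (\sum_(i < n) a i * X i w + p))
| trig_polyD f g : trig_poly f -> trig_poly g -> trig_poly (f \+ g)
| trig_polyZ c f : trig_poly f -> trig_poly (fun w => c * f w).

Let trig_polyM f g : trig_poly f -> trig_poly g -> trig_poly (f \* g).
Proof.
move=> tf tg; elim: tf => {f} [a p|f1 f2 _ IH1 _ IH2|c f _ IH]; last 2 first.
- rewrite (_ : _ \* _ = (f1 \* g) \+ (f2 \* g)); first exact: trig_polyD.
  by apply/funext => w /=; rewrite mulrDl.
- rewrite (_ : _ \* _ = fun w => c * (f \* g) w); first exact: trig_polyZ.
  by apply/funext => w /=; rewrite mulrA.
elim: tg => {g} [b q|f1 f2 _ IH1 _ IH2|c f _ IH]; last 2 first.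
- set f := fun w => cos _.
  rewrite (_ : _ \* _ = (f \* f1) \+ (f \* f2)); first exact: trig_polyD.
  by apply/funext => w /=; rewrite mulrDr.
- set h := fun w => cos _.
  rewrite (_ : _ \* _ = fun w => c * (h \* f) w); first exact: trig_polyZ.
  by apply/funext => w /=; rewrite mulrCA.
set f := fun w => cos (\sum_(i < n) (a i + b i) * X i w + (p + q)).
set g := fun w => cos (\sum_(i < n) (a i - b i) * X i w + (p - q)).
rewrite (_ : _ \* _ = fun w => 2^-1 * (f \+ g) w).
  by apply: trig_polyZ; apply: trig_polyD; exact: trig_poly_cos.
apply/funext => w /=; rewrite /f /g.
have -> : \sum_(i < n) (a i + b i) * X i w =
    \sum_(i < n) a i * X i w + \sum_(i < n) b i * X i w.
  by rewrite -big_split; apply: eq_bigr => i _; rewrite mulrDl.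
have -> : \sum_(i < n) (a i - b i) * X i w =
    \sum_(i < n) a i * X i w - \sum_(i < n) b i * X i w.
  by rewrite -sumrB; apply: eq_bigr => i _; rewrite mulrBl.
set x := \sum_(i < n) a i * X i w; set y := \sum_(i < n) b i * X i w.
have -> : x + y + (p + q) = (x + p) + (y + q) by ring.
have -> : x - y + (p - q) = (x + p) - (y + q) by ring.
by move: (x + p) (y + q) => {}x {}y; rewrite cosD cosB; field.
Qed.

Let trig_poly_cst c : trig_poly (cst c).
Proof.
rewrite (_ : cst c = fun w => c * cos (\sum_(i < n) 0 * X i w + 0)).
  by apply: trig_polyZ; exact: trig_poly_cos.
apply/funext => w /=; rewrite big1 ?addr0 ?cos0 ?mulr1// => i _.
by rewrite mul0r.
Qed.

Let trig_poly_sin (i : 'I_n) (c p : R) :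
  trig_poly (fun w => sin (c * X i w + p)).
Proof.
have := trig_poly_cos (fun j => if j == i then c else 0) (p - pi / 2).
congr trig_poly; apply/funext => w; rewrite (bigD1 i)//= eqxx big1 ?addr0.
  by rewrite addrA -cosBpihalf.
by move=> j /negbTE ->; rewrite mul0r.
Qed.

Let trig_poly_halfcube k f : trig_poly f ->
  trig_poly (fun w => iter k halfcube (f w)).
Proof.
move=> tf; elim: k => //= k; set g := fun w => _ => tg.
rewrite (_ : (fun w => _) = (fun w => 2^-1 *
  (g \* (cst 3 \+ (fun w => (-1) * (g \* g) w))) w)).
  by apply: trig_polyZ; apply: trig_polyM => //; apply: trig_polyD => //;
    apply: trig_polyZ; exact: trig_polyM.
by apply/funext => w /=; rewrite /halfcube -/(g w); ring.
Qed.

Let trig_poly_step f : trig_poly f -> trig_poly (fun w => step (f w)).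
Proof.
move=> tf; rewrite (_ : (fun w => _) = fun w => 2^-1 * (f \+ f \* f) w).
  by apply: trig_polyZ; apply: trig_polyD => //; exact: trig_polyM.
by apply/funext => w; rewrite /step /=; ring.
Qed.

Let trig_poly_prod (f : 'I_n -> T -> R) :
  (forall i, trig_poly (f i)) -> trig_poly (fun w => \prod_(i < n) f i w).
Proof.
move=> tf; elim: (index_enum _) => [|i s IH].
  rewrite (_ : (fun w => _) = cst 1) //.
  by apply/funext => w; rewrite big_nil.
rewrite (_ : (fun w => _) = f i \* (fun w => \prod_(j <- s) f j w)).
  exact: trig_polyM.
by apply/funext => w; rewrite big_cons.
Qed.

Definition orthant (b : 'I_n -> R) : set T :=
  [set w | forall i, b i < X i w].

(* The sign function is the limit of the iterates of s |-> s (3 - s^2) / 2 on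
   [-1, 1], and sgn x = lim_m sgn (sin (x / m)): the indicator of an orthant is
   thus an iterated bounded limit of trigonometric polynomials. *)
Lemma orthant_indicator_closure (H : (T -> R) -> Prop) :
  (forall a p, H (fun w => cos (\sum_(i < n) a i * X i w + p))) ->
  (forall f g, H f -> H g -> H (f \+ g)) ->
  (forall c f, H f -> H (fun w => c * f w)) ->
  (forall (f_ : nat -> T -> R) (f : T -> R), (forall k, H (f_ k)) ->
     (forall k w, `|f_ k w| <= 1) -> (forall w, f_ ^~ w @ \oo --> f w) ->
     H f) ->
  forall b, H \1_(orthant b).
Proof.
move=> Hcos HD HZ Hlim b.
have Htrig f : trig_poly f -> H f.
  by elim=> {f} [a p|f g _ ? _ ?|c f _ ?]; [exact: Hcos|exact: HD|exact: HZ].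
have norm_prod (f : 'I_n -> R) : (forall i, `|f i| <= 1) ->
    `|\prod_(i < n) f i| <= 1.
  move=> f1; rewrite normr_prod; apply: prodr_ile1 => i _.
  by rewrite normr_ge0 f1.
have sin1 x : `|sin x| <= 1 :> R by rewrite ler_norml sin_geN1 sin_le1.
have sg1 x : `|Num.sg x| <= 1 :> R by rewrite normr_sg lern1 leq_b1.
(* Two nested limits: for fixed [m], [g m] is itself a limit of trigonometric polynomials, and the
   indicator is the limit of [g m]. Every factor stays in [-1, 1], which gives the uniform bound 1
   required by the closure hypothesis. *)
pose g m w := \prod_(i < n) step (Num.sg (sin ((X i w - b i) / m.+1%:R))).
apply: (Hlim g).
- move=> m; pose f k w :=
    \prod_(i < n) step (iter k halfcube (sin ((X i w - b i) / m.+1%:R))).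
  apply: (Hlim f).
  + move=> k; apply: Htrig; apply: trig_poly_prod => i.
    apply: trig_poly_step; apply: trig_poly_halfcube.
    rewrite (_ : (fun w => _) =
      fun w => sin (m.+1%:R^-1 * X i w + - b i / m.+1%:R)) //.
    by apply/funext => w; congr sin; rewrite mulrBl mulrC mulNr.
  + by move=> k w; apply: norm_prod => i; apply: step_norm_le1;
      exact: halfcube_iter_norm_le1.
  + move=> w; apply: cvg_big => [|i _]; first exact: mul_continuous.
    by apply: cvg_step; exact: cvg_halfcube_iter.
- by move=> m w; apply: norm_prod => i; exact: step_norm_le1.
move=> w; have -> : \1_(orthant b) w =
    \prod_(i < n) step (Num.sg (X i w - b i)) :> R.
  under eq_bigr do rewrite step_sg subr_gt0.
  rewrite indicE; have [|] := boolP (w \in orthant b).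
    by rewrite inE => bw; rewrite big1// => i _; rewrite bw.
  rewrite notin_setE => /existsNP[i /negP/negbTE bw].
  by rewrite (bigD1 i)//= bw mul0r.
apply: cvg_big => [|i _]; first exact: mul_continuous.
by apply: cvg_step; exact: cvg_sg_sin.
Qed.

End Family.
End TrigonometricClosure.

(** * Cosine transforms determine laws and independence *)

Section Image.
Context {R : realType} {d d' : measure_display}.
Context {T : measurableType d} {F : measurableType d'}.
Variables (m : {measure set T -> \bar R}) (V : T -> F).
Hypothesis mV : measurable_fun [set: T] V.

Definition image : {measure set F -> \bar R} :=
  measure_function_pushforward__canonical__measure_function_Measure m mV.

End Image.

Section Law.
Context {R : realType} {d d' : measure_display}.
Context {T : measurableType d} {F : measurableType d'}.
Variables (P : probability T R) (V : T -> F).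
Hypothesis mV : measurable_fun [set: T] V.

Let V' : {mfun T >-> F} := HB.pack V (isMeasurableFun.Build _ _ _ _ _ mV).

Definition law : probability F R := distribution P V'.

Lemma lawE A : law A = P (V @^-1` A). Proof. by []. Qed.

Lemma integral_law (f : F -> \bar R) : measurable_fun [set: F] f ->
  P.-integrable [set: T] (f \o V) ->
  (\int[law]_y f y = \int[P]_w f (V w))%E.
Proof. by move=> mf fV; rewrite /law integral_distribution. Qed.

Lemma integrable_law (f : F -> \bar R) : measurable_fun [set: F] f ->
  P.-integrable [set: T] (f \o V) -> law.-integrable [set: F] f.
Proof. by move=> mf fV; exact: integrable_pushforward. Qed.

End Law.

Section Integrals.
Context {R : realType} {d : measure_display} {T : measurableType d}.

Lemma eq_measure_integrable (m1 m2 : {measure set T -> \bar R})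
    (f : T -> \bar R) : (forall A, measurable A -> m1 A = m2 A) ->
  m1.-integrable [set: T] f -> m2.-integrable [set: T] f.
Proof.
move=> m12 /integrableP[mf fi]; apply/integrableP; split => //.
by rewrite (eq_measure_integral m1)// => A mA _; rewrite m12.
Qed.

Variable P : {finite_measure set T -> \bar R}.

Lemma bounded_RintegralD (f g : T -> R) :
  bounded_measurable f -> bounded_measurable g ->
  \int[P]_w (f w + g w) = \int[P]_w f w + \int[P]_w g w.
Proof.
by move=> bf bg; rewrite RintegralD//; exact: bounded_measurable_integrable.
Qed.

Lemma bounded_RintegralB (f g : T -> R) :
  bounded_measurable f -> bounded_measurable g ->
  \int[P]_w (f w - g w) = \int[P]_w f w - \int[P]_w g w.
Proof.
by move=> bf bg; rewrite RintegralB//; exact: bounded_measurable_integrable.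
Qed.

Lemma bounded_RintegralZl (c : R) (f : T -> R) : bounded_measurable f ->
  \int[P]_w (c * f w) = c * \int[P]_w f w.
Proof.
by move=> bf; rewrite RintegralZl//; exact: bounded_measurable_integrable.
Qed.

Lemma bounded_cvg_Rintegral (f_ : nat -> T -> R) (f h : T -> R) :
  bounded_measurable h -> (forall k, bounded_measurable (f_ k)) ->
  (forall k w, `|f_ k w| <= 1) -> (forall w, f_ ^~ w @ \oo --> f w) ->
  bounded_measurable f /\
  \int[P]_w (f_ k w * h w) @[k --> \oo] --> \int[P]_w (f w * h w).
Proof.
move=> [mh [M hM]] bf f1 ff; split.
  split; first by apply: (measurable_fun_cvg (fun k => (bf k).1)) => w _.
  exists 1 => w; move/cvg_norm/cvgr_to_le : (ff w); apply.
  by apply: nearW => k.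
have [|||||_ //] := @cvg_Rintegral R d T P [set: T] (fun k => f_ k \* h) (f \* h)
  (cst M).
- by [].
- by move=> k; apply: measurable_funM => //; exact: (bf k).1.
- by apply: bounded_measurable_integrable; exact: bounded_measurable_cst.
- by move=> w _; apply: cvgM => //; exact: cvg_cst.
- by move=> k w _ /=; rewrite normrM -[leRHS]mul1r ler_pM.
Qed.

End Integrals.

Section TupleUniqueness.
Context {R : realType} {n : nat}.

Lemma measurable_orthant {d} {T : measurableType d} (X : 'I_n -> T -> R) b :
  (forall i, measurable_fun [set: T] (X i)) -> measurable (orthant X b).
Proof.
move=> mX; rewrite (_ : orthant X b = \bigcap_(i in [set: 'I_n])
  ([set: T] `&` X i @^-1` `]b i, +oo[%classic)).
  by apply: fin_bigcap_measurable => // i _; apply: mX.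
apply/seteqP; split => [w Xw i _|w Xw i].
  by split => //=; rewrite in_itv/= andbT; exact: Xw.
by have [_] := Xw i I; rewrite /= in_itv/= andbT.
Qed.

Let coord (i : 'I_n) (x : n.-tuple R) : R := tnth x i.
Let G : set (set (n.-tuple R)) := [set A | exists b, A = orthant coord b].

Let cover (x : n.-tuple R) : exists k : nat, forall i, - k%:R < coord i x.
Proof.
exists (Num.bound (\sum_(i < n) `|coord i x|)) => i.
rewrite ltrNl; apply: le_lt_trans (archi_boundP _); last exact: sumr_ge0.
rewrite (bigD1 i)//= (le_trans (ler_norm _))// normrN lerDl.
exact: sumr_ge0.
Qed.

Let measurable_tupleE : @measurable _ (n.-tuple R) = <<s G >>.
Proof.
apply/seteqP; split => A; last first.
  move: A; apply: smallest_sub; first exact: sigma_algebra_measurable.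
  by move=> _ [b ->]; apply: measurable_orthant => i; exact: measurable_tnth.
move=> mA.
have : measurable_fun [set: g_sigma_algebraType G]
    (fun x : g_sigma_algebraType G => x : n.-tuple R).
  apply/measurable_fun_tnthP => i.
  apply: (measurability _ (RGenOInfty.measurableE R)) => _ [_ [b ->] <-].
  (* A half-space in coordinate [i] is the union over [k] of the orthants with threshold [b] at [i]
     and -k at all other coordinates. *)
  pose c k j : R := if j == i then b else - k%:R.
  rewrite (_ : _ `&` _ = \bigcup_k orthant coord (c k)).
    apply: bigcup_measurable => k _; apply: sub_sigma_algebra.
    by exists (c k).
  apply/seteqP; split => [x [_]|x [k _ xk]].
    rewrite /= in_itv/= andbT => bx; have [k xk] := cover x.
    by exists k => // j; rewrite /c; case: eqVneq => [->|_].
  by split => //=; rewrite in_itv/= andbT; have := xk i; rewrite /c eqxx.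
by move=> /(_ measurableT _ mA); rewrite setTI.
Qed.

(** Open orthants are stable under intersection (coordinatewise maximum of the thresholds), generate
    the measurable sets, and exhaust the space as the common threshold -k decreases. *)
Lemma tuple_measure_unique (m1 m2 : {measure set (n.-tuple R) -> \bar R}) :
  (m1 [set: n.-tuple R] < +oo)%E ->
  (forall b, m1 (orthant (fun i x => tnth x i) b) =
             m2 (orthant (fun i x => tnth x i) b)) ->
  forall A, measurable A -> m1 A = m2 A.
Proof.
move=> m1oo m12 A mA.
apply: (@measure_unique _ _ _ G (fun k => orthant coord (fun=> - k%:R))) => //.
- move=> _ _ [b ->] [c ->]; exists (fun i => Num.max (b i) (c i)).
  apply/seteqP; split => [x [xb xc] i|x xbc]; first by rewrite gt_max xb xc.
  by split => i; have := xbc i; rewrite gt_max => /andP[].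
- by move=> k; exists (fun=> - k%:R).
- by rewrite -subTset => x _; have [k xk] := cover x; exists k.
- by move=> _ [b ->]; exact: m12.
- move=> k; apply: le_lt_trans m1oo; apply: le_measure; rewrite ?inE//.
  by apply: measurable_orthant => i; exact: measurable_tnth.
Qed.

End TupleUniqueness.

Section Independence.
Context {R : realType} {d d1 d2 : measure_display}.
Context {T : measurableType d} {F1 : measurableType d1} {F2 : measurableType d2}.
Variables (P : probability T R) (V : T -> F1) (X : T -> F2).
Hypotheses (mV : measurable_fun [set: T] V) (mX : measurable_fun [set: T] X).
Hypothesis VX : forall A B, measurable A -> measurable B ->
  P (V @^-1` A `&` X @^-1` B) = (P (V @^-1` A) * P (X @^-1` B))%E.

Lemma law_pair A : measurable A ->
  law P _ (measurable_fun_pair mV mX) A = (law P _ mV \x law P _ mX)%E A.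
Proof.
by move=> mA; apply/esym; apply: (product_measure_unique _ mA) => B C mB mC;
  exact: VX.
Qed.

(** Fubini for the product law of the pair. One factor may be unbounded, so that [f] can be a
    coordinate of the residual, or a product of two, against the indicator of an event of the
    conditioning variable. *)
Lemma independent_Rintegral (f : F1 -> R) (g : F2 -> R) :
  measurable_fun [set: F1] f -> P.-integrable [set: T] (EFin \o (f \o V)) ->
  bounded_measurable g ->
  \int[P]_w (f (V w) * g (X w)) = \int[P]_w f (V w) * \int[P]_w g (X w).
Proof.
move=> mf fi bg; have mg := bg.1.
have bgX : bounded_measurable (g \o X).
  split; first exact: measurableT_comp.
  by have [_ [M gM]] := bg; exists M => w /=.
pose h (z : F1 * F2) := (f z.1 * g z.2)%:E.
have mh : measurable_fun [set: F1 * F2] h.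
  by apply/measurable_EFinP; apply: measurable_funM; exact: measurableT_comp.
have hi : P.-integrable [set: T] (fun w => h (V w, X w)).
  have [_ [M gM]] := bgX.
  apply: (@integrableMl _ _ _ P _ measurableT (EFin \o (f \o V)) (g \o X)) => //.
    exact: bgX.1.
  by exists M; split; [exact: num_real|] => N MN x _ /=;
    rewrite (le_trans (gM x))// ltW.
have gi : P.-integrable [set: T] (EFin \o (g \o X)).
  exact: bounded_measurable_integrable.
have -> : \int[P]_w (f (V w) * g (X w)) =
    fine (\int[(law P _ mV \x law P _ mX)%E]_z h z)%E.
  transitivity (fine (\int[law P _ (measurable_fun_pair mV mX)]_z h z)%E).
    by congr fine; rewrite integral_law.
  by congr fine; apply: eq_measure_integral => A mA _; exact: law_pair.
rewrite -integral12_prod_meas1//; last first.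
  apply: (@eq_measure_integrable _ _ _
    (law P _ (measurable_fun_pair mV mX))); first exact: law_pair.
  exact: integrable_law.
rewrite (eq_integral (fun x => (f x)%:E * (\int[P]_w g (X w))%:E)%E).
  rewrite (integral_law P _ mV (fun x => (f x)%:E * _)%E); last 2 first.
  - by apply: emeasurable_funM => //; exact/measurable_EFinP.
  - exact: integrableZr.
  rewrite integralZr// fineM//; exact: integrable_fin_num.
move=> x _; rewrite /fubini_F /h /=.
under eq_integral do rewrite EFinM.
rewrite integralZl//; last first.
  by apply: integrable_law => //; exact/measurable_EFinP.
rewrite (integral_law P _ mX (EFin \o g)) => //; last exact/measurable_EFinP.
by rewrite /Rintegral fineK//; exact: integrable_fin_num.
Qed.

End Independence.

Section CosineTransform.
Context {R : realType} {d : measure_display} {T : measurableType d}.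
Variable P : probability T R.

Let lin {n} (X : T -> n.-tuple R) (a : 'I_n -> R) (p : R) (w : T) : R :=
  cos (\sum_(i < n) a i * tnth (X w) i + p).

Let bounded_lin n (X : T -> n.-tuple R) a p :
  measurable_fun [set: T] X -> bounded_measurable (lin X a p).
Proof.
move=> mX; apply: bounded_measurable_cos; apply: measurable_funD => //.
apply: measurable_sum => i; apply: measurable_funM => //.
by move/measurable_fun_tnthP : mX; exact.
Qed.

(** For a fixed bounded weight [h], factorization is linear in the other function and survives
    bounded limits, so it passes from cosines to indicators of orthants. *)
Let factor_orthant n (X : T -> n.-tuple R) (h : T -> R) b :
  measurable_fun [set: T] X -> bounded_measurable h ->
  (forall a p, \int[P]_w (lin X a p w * h w) =
               \int[P]_w lin X a p w * \int[P]_w h w) ->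
  let A := orthant (fun i w => tnth (X w) i) b in
  \int[P]_w (\1_A w * h w) = \int[P]_w \1_A w * \int[P]_w h w.
Proof.
move=> mX bh Xh A.
pose H f := bounded_measurable f /\
  \int[P]_w (f w * h w) = \int[P]_w f w * \int[P]_w h w.
suff [] : H \1_A by [].
apply: orthant_indicator_closure.
- by move=> a p; split; [exact: bounded_lin|exact: Xh].
- move=> f g [bf fh] [bg gh]; split; first exact: bounded_measurableD.
  under eq_Rintegral do rewrite mulrDl.
  rewrite !bounded_RintegralD ?fh ?gh ?mulrDl//; exact: bounded_measurableM.
- move=> c f [bf fh]; split.
    by apply: bounded_measurableM => //; exact: bounded_measurable_cst.
  under eq_Rintegral do rewrite -mulrA.
  rewrite !bounded_RintegralZl ?fh ?mulrA//; exact: bounded_measurableM.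
- move=> f_ f Hf f1 ff.
  have bf k : bounded_measurable (f_ k) by have [] := Hf k.
  have [bfl] := bounded_cvg_Rintegral P _ _ _ bh bf f1 ff.
  have [_] := bounded_cvg_Rintegral P _ _ _ (bounded_measurable_cst 1) bf f1 ff.
  have E1 g : \int[P]_w (g w * cst 1 w) = \int[P]_w g w.
    by apply: eq_Rintegral => w _; rewrite mulr1.
  under eq_fun do rewrite E1; rewrite E1 => c1 c2.
  split => //; apply: (cvg_unique _ c2) => //.
  rewrite (_ : (fun k => _) = fun k => \int[P]_w f_ k w * \int[P]_w h w).
    by apply: cvgM => //; exact: cvg_cst.
  by apply/funext => k; exact: (Hf k).2.
Qed.

(** Uniqueness applied to two finite measures in [A]: the law of [X] restricted to the event [D],
    and the law of [X] scaled by the probability of [D]. *)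
Lemma factor_tuple n (X : T -> n.-tuple R) (D : set T) :
  measurable_fun [set: T] X -> measurable D ->
  (forall a, P (orthant (fun i w => tnth (X w) i) a `&` D) =
             (P (orthant (fun i w => tnth (X w) i) a) * P D)%E) ->
  forall A, measurable A -> P (X @^-1` A `&` D) = (P (X @^-1` A) * P D)%E.
Proof.
move=> mX mD PX A mA.
have PD0 : 0 <= fine (P D) by rewrite fine_ge0.
have scaleE B : mscale (NngNum PD0) (law P X mX) B = (P (X @^-1` B) * P D)%E.
  by rewrite /mscale/= fineK ?fin_num_measure// muleC.
rewrite -scaleE -(tuple_measure_unique (image (mrestr P mD) X mX))//.
  have : (P D < +oo)%E by rewrite -ge0_fin_numE// fin_num_measure.
  by rewrite /image /= /pushforward /mrestr preimage_setT setTI.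
by move=> b; apply: (etrans (PX b)); apply/esym; exact: scaleE.
Qed.

Lemma independent_of_cos n m (X : T -> n.-tuple R) (Y : T -> m.-tuple R) :
  measurable_fun [set: T] X -> measurable_fun [set: T] Y ->
  (forall a b p q,
    \int[P]_w (cos (\sum_(i < n) a i * tnth (X w) i + p) *
               cos (\sum_(i < m) b i * tnth (Y w) i + q)) =
    \int[P]_w cos (\sum_(i < n) a i * tnth (X w) i + p) *
    \int[P]_w cos (\sum_(i < m) b i * tnth (Y w) i + q)) ->
  forall A B, measurable A -> measurable B ->
    P (X @^-1` A `&` Y @^-1` B) = (P (X @^-1` A) * P (Y @^-1` B))%E.
Proof.
move=> mX mY XY.
have bind n' (Z : T -> n'.-tuple R) c : measurable_fun [set: T] Z ->
    let C := orthant (fun i w => tnth (Z w) i) c in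
    measurable C /\ bounded_measurable (\1_C : T -> R).
  move=> mZ C; have mC : measurable C.
    by apply: measurable_orthant => i; move/measurable_fun_tnthP : mZ; exact.
  split => //; split; first exact: measurable_indic.
  by exists 1 => w; rewrite indicE ger0_norm ?ler0n// lern1 leq_b1.
have Eind (C : set T) : measurable C ->
    (\int[P]_w \1_C w)%:E = P C :> \bar R.
  by move=> mC; rewrite /Rintegral integral_indic// setIT fineK// fin_num_measure.
have PXY a b : P (orthant (fun i w => tnth (X w) i) a `&`
      orthant (fun i w => tnth (Y w) i) b) =
    (P (orthant (fun i w => tnth (X w) i) a) *
     P (orthant (fun i w => tnth (Y w) i) b))%E.
  set A := orthant _ a; set B := orthant _ b.
  have [mA bA] := bind _ X a mX; have [mB bB] := bind _ Y b mY.
  (* The factors are replaced one at a time: here the cosine of [X] becomes the indicator of [A]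
     against a cosine of [Y]; afterwards that indicator is the weight while the cosine of [Y] is
     replaced. *)
  have XA c q : \int[P]_w (lin Y c q w * \1_A w) =
      \int[P]_w lin Y c q w * \int[P]_w \1_A w.
    under eq_Rintegral do rewrite mulrC.
    rewrite [RHS]mulrC; apply: factor_orthant => //; first exact: bounded_lin.
    by move=> a' p; exact: XY.
  have := factor_orthant _ Y \1_A b mY bA XA; rewrite -/B => AB.
  rewrite -!Eind//; last exact: measurableI.
  rewrite -EFinM mulrC -AB; congr EFin; apply: eq_Rintegral => w _.
  by rewrite indicI mulrC.
move=> A B mA mB.
have mXA : measurable (X @^-1` A) by rewrite -[X in measurable X]setTI; exact: mX.
rewrite setIC muleC; apply: factor_tuple => // b.
have [mO _] := bind _ Y b mY.
by rewrite setIC muleC; apply: factor_tuple.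
Qed.

(** The class of test functions with equal integrals under both laws is closed under the operations
    that build orthant indicators; in dimension one orthants are the rays ]b, +oo[. The measure [N]
    will be a normal law or, for zero variance, a Dirac mass. *)
Lemma law_unique_of_cos (X : T -> R)
    (N : probability (measurableTypeR R) R) :
  measurable_fun [set: T] X ->
  (forall a p, \int[P]_w cos (a * X w + p) = \int[N]_x cos (a * x + p)) ->
  forall A, measurable A -> P (X @^-1` A) = N A.
Proof.
move=> mX XN.
have bX (f : R -> R) : bounded_measurable f -> bounded_measurable (f \o X).
  move=> [mf [M fM]]; split; first exact: measurableT_comp.
  by exists M => w /=.
have PN b : P (X @^-1` `]b, +oo[%classic) = N `]b, +oo[%classic.
  pose H (f : R -> R) := bounded_measurable f /\
    \int[P]_w f (X w) = \int[N]_x f x.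
  have OE : orthant (fun (i : 'I_1) (x : R) => x) (fun=> b) = `]b, +oo[%classic.
    apply/seteqP; split => [x /(_ ord0)|x]; rewrite /= in_itv/= andbT//.
    by move=> bx i.
  have : H \1_(orthant (fun (i : 'I_1) (x : R) => x) (fun=> b)).
    apply: orthant_indicator_closure.
    - move=> a p; split.
        apply: bounded_measurable_cos; apply: measurable_funD => //.
        by apply: measurable_sum => i; apply: measurable_funM.
      transitivity (\int[P]_w cos (a ord0 * X w + p)).
        by apply: eq_Rintegral => w _; rewrite big_ord1.
      by rewrite XN; apply: eq_Rintegral => w _; rewrite big_ord1.
    - move=> f g [bf fN] [bg gN]; split; first exact: bounded_measurableD.
      rewrite bounded_RintegralD//; last 2 first; [exact: bX|exact: bX|].
      by rewrite bounded_RintegralD// fN gN.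
    - move=> c f [bf fN]; split.
        by apply: bounded_measurableM => //; exact: bounded_measurable_cst.
      by rewrite !bounded_RintegralZl ?fN//; exact: bX.
    - move=> f_ f Hf f1 ff.
      have bf k : bounded_measurable (f_ k) by have [] := Hf k.
      have [bfl c1] := bounded_cvg_Rintegral N _ _ _
        (bounded_measurable_cst 1) bf f1 ff.
      have [_ c2] := bounded_cvg_Rintegral P _ _ _
        (bounded_measurable_cst 1) (fun k => bX _ (bf k))
        (fun k w => f1 k (X w)) (fun w => ff (X w)).
      split => //.
      have E1 d' (T' : measurableType d') (Q : probability T' R) g :
          \int[Q]_w (g w * cst 1 w) = \int[Q]_w g w.
        by apply: eq_Rintegral => w _; rewrite mulr1.
      rewrite -E1 -[RHS]E1; apply: (cvg_unique _ c2) => //.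
      rewrite (_ : (fun k => _) = fun k => \int[N]_w (f_ k w * cst 1 w))//.
      by apply/funext => k; rewrite !E1; exact: (Hf k).2.
  rewrite OE => -[_ HE].
  have mO : measurable (`]b, +oo[%classic : set R) by [].
  have mXO : measurable (X @^-1` `]b, +oo[%classic).
    by rewrite -[X in measurable X]setTI; exact: mX.
  transitivity (\int[P]_w \1_(X @^-1` `]b, +oo[%classic) w)%:E.
    by rewrite /Rintegral integral_indic// setIT fineK// fin_num_measure.
  transitivity (\int[N]_x \1_(`]b, +oo[%classic : set R) x)%:E.
    by rewrite -HE.
  by rewrite /Rintegral integral_indic// setIT fineK// fin_num_measure.
move=> A mA.
apply: (@measure_unique _ R (measurableTypeR R) (@RGenOInfty.G R)
  (fun k => `]- k%:R, +oo[%classic) _ _ _ _ (@law R _ _ T (measurableTypeR R) P X mX) N) => //.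
- exact: RGenOInfty.measurableE.
- move=> _ _ [b ->] [c ->]; exists (Num.max b c).
  apply/seteqP; split => x; rewrite /= !in_itv/= !andbT gt_max.
    by move=> [-> ->].
  by move=> /andP[].
- by move=> k; exists (- k%:R).
- rewrite -subTset => x _; exists (Num.bound `|x|) => //.
  rewrite /= in_itv/= andbT ltrNl (le_lt_trans (ler_norm _))// normrN.
  exact: archi_boundP.
- by move=> _ [b ->]; exact: PN.
- by move=> k; rewrite -ge0_fin_numE// fin_num_measure.
Qed.

End CosineTransform.

(** * The cosine transform of the normal law *)

Section NormalCosine.
Context {R : realType}.
Notation mu := (@lebesgue_measure R).

Let is_derive_affine (a b x : R) : is_derive x 1 (fun y : R => a * y + b) a.
Proof.
rewrite (_ : (fun y => _) = (a *: (id : R -> R)) + cst b); last first.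
  by apply/funext => y.
by apply: is_derive_eq; rewrite addr0 /GRing.scale /= mulr1.
Qed.

Let is_derive_continuous (f df : R -> R) :
  (forall x : R, is_derive x 1 f (df x)) -> continuous f.
Proof.
by move=> fdf x; apply/differentiable_continuous/derivable1_diffP; case: (fdf x).
Qed.

(** The fundamental theorem of calculus on growing symmetric segments, followed by dominated
    convergence; boundary values are controlled along integers only. *)
Lemma Rintegral_derive_eq0 (f df : R -> R) :
  (forall x : R, is_derive x 1 f (df x)) -> continuous df ->
  mu.-integrable [set: R] (EFin \o df) ->
  f n%:R @[n --> \oo] --> (0 : R) -> f (- n%:R) @[n --> \oo] --> (0 : R) ->
  \int[mu]_x df x = 0.
Proof.
move=> fdf cdf idf fy fNy.
have cf := is_derive_continuous _ _ fdf.
pose A n : set R := `[- n.+1%:R, n.+1%:R]%classic.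
have AE n : \int[mu]_x (df x * \1_(A n) x) = f n.+1%:R - f (- n.+1%:R).
  have lt0 : - n.+1%:R < n.+1%:R :> R by rewrite gtrN.
  rewrite /Rintegral -[RHS]/(fine (f n.+1%:R - f (- n.+1%:R))%:E); congr fine.
  transitivity (\int[mu]_(x in A n) (df x)%:E)%E.
    rewrite [RHS]integral_mkcond; apply: eq_integral => x _.
    by rewrite patchE indicE; case: (x \in A n); rewrite ?mulr1 ?mulr0.
  rewrite (@continuous_FTC2 R df f)//.
  - exact: continuous_subspaceT.
  - split => [x _||].
    + by case: (fdf x).
    + by apply: cvg_at_right_filter; exact: cf.
    + by apply: cvg_at_left_filter; exact: cf.
  - by move=> x _; rewrite derive1E; exact: derive_val.
have [|||||_ c1] := @cvg_Rintegral R _ (measurableTypeR R) mu [set: R]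
    (fun n x => df x * \1_(A n) x) df (fun x => `|df x|).
- by [].
- move=> n; apply: measurable_funM; first exact: continuous_measurable_fun.
  by apply: measurable_indic; rewrite /A.
- exact: integrable_norm.
- move=> x _; apply: cvg_near_cst; near=> n.
  rewrite indicE mem_set ?mulr1// /A /= in_itv/= -ler_norml.
  rewrite (le_trans (ltW (archi_boundP (normr_ge0 x))))// ler_nat.
  by apply: leqW; near: n; exact: nbhs_infty_ge.
- move=> n x _ /=; rewrite normrM ler_piMr// indicE.
  by rewrite ger0_norm ?ler0n// lern1 leq_b1.
suff c2 : (\int[mu]_x (df x * \1_(A n) x)) @[n --> \oo] --> (0 : R).
  exact: (cvg_unique _ c1 c2).
rewrite (_ : (fun n => _) = fun n => f n.+1%:R - f (- n.+1%:R)).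
  rewrite -[X in _ --> X]subr0; apply: cvgB.
    by rewrite (cvg_shiftS (fun n => f n%:R)).
  by rewrite (cvg_shiftS (fun n => f (- n%:R))).
by apply/funext => n; rewrite AE.
Unshelve. all: by end_near. Qed.

Variables (m s : R).
Hypothesis s0 : s != 0.
Let pdf := normal_pdf m s.

Let pdfE x : pdf x = normal_peak s * expR (- (x - m) ^+ 2 / (s ^+ 2 *+ 2)).
Proof. by rewrite /pdf normal_pdfE. Qed.

Let is_derive_pdf (x : R) : is_derive x 1 pdf (- ((x - m) / s ^+ 2 * pdf x)).
Proof.
have -> : pdf = normal_peak s \*o
    (expR \o (fun x => - (x - m) ^+ 2 / (s ^+ 2 *+ 2))).
  by apply/funext => y; rewrite pdfE.
have d1 : is_derive x 1 (fun x => - (x - m) ^+ 2 / (s ^+ 2 *+ 2))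
   (- ((x - m) / s ^+ 2)).
  rewrite (_ : (fun x => _) =
    (- (s ^+ 2 *+ 2)^-1) *: (fun x => 1 * x + - m) ^+ 2); last first.
    by apply/funext => y; rewrite !fctE /GRing.scale /= mul1r mulNr [RHS]mulNr mulrC.
  apply: is_derive_eq.
  rewrite /GRing.scale /= !mulr1 expr1 mul1r -(mulr_natr (s ^+ 2)).
  by field.
rewrite (_ : _ \*o _ = normal_peak s *: (expR \o
  (fun x => - (x - m) ^+ 2 / (s ^+ 2 *+ 2))))//.
by apply: is_derive_eq; rewrite !fctE /GRing.scale/=; ring.
Qed.

(** Half of the Gaussian exponent absorbs the linear factor: with e = exp (- (x - m)^2 / (4 s^2)),
    the density is its peak times e^2 and |x - m| e <= 2 |s|. What remains is a multiple of the
    normal density of deviation sqrt 2 s. *)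
Let integrable_xpdf : mu.-integrable [set: R]
  (EFin \o (fun x => `|x - m| * pdf x)).
Proof.
have c0 : Num.sqrt 2 * s != 0 :> R by rewrite mulf_neq0// sqrtr_eq0 -ltNge.
have c1 : s ^+ 2 *+ 2 = 2 * s ^+ 2 by rewrite mulr_natl.
have c2 : (Num.sqrt 2 * s) ^+ 2 *+ 2 = 4 * s ^+ 2.
  by rewrite exprMn sqr_sqrtr// -mulr_natl; ring.
pose C := 2 * `|s| * normal_peak s / normal_peak (Num.sqrt 2 * s).
apply: (@le_integrable _ (measurableTypeR R) R mu [set: R] measurableT _
  (EFin \o (fun x => C * normal_pdf m (Num.sqrt 2 * s) x))); last 2 first.
- move=> x _; rewrite /= lee_fin ger0_norm; last first.
    by rewrite mulr_ge0// normal_pdf_ge0.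
  apply: le_trans (ler_norm _); rewrite pdfE normal_pdfE// /C.
  rewrite [leRHS]mulrA divfK ?gt_eqF ?normal_peak_gt0//.
  have -> : - (x - m) ^+ 2 / (s ^+ 2 *+ 2) =
      - (x - m) ^+ 2 / ((Num.sqrt 2 * s) ^+ 2 *+ 2) +
      - (x - m) ^+ 2 / ((Num.sqrt 2 * s) ^+ 2 *+ 2).
    by rewrite c1 c2; field.
  rewrite expRD /normal_fun; set e := expR _.
  rewrite [leLHS](_ : _ = normal_peak s * e * (`|x - m| * e)); last by ring.
  rewrite [leRHS](_ : _ = normal_peak s * e * (2 * `|s|)); last by ring.
  rewrite ler_wpM2l ?mulr_ge0 ?normal_peak_ge0 ?expR_ge0//.
  rewrite /e mulNr expRN ler_pdivrMr ?expR_gt0//.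
  have := expR_ge1Dx ((x - m) ^+ 2 / ((Num.sqrt 2 * s) ^+ 2 *+ 2)).
  move/(ler_wpM2l (_ : 0 <= 2 * `|s|)) => h; apply: le_trans (h _).
    rewrite c2.
    rewrite -[(x - m) ^+ 2]real_normK ?num_real// -[s ^+ 2]real_normK ?num_real//.
    have sp : 0 < `|s| by rewrite normr_gt0.
    move: (`|x - m|) (`|s|) (normr_ge0 (x - m)) sp => y z y0 z0.
    have -> : 2 * z * (1 + y ^+ 2 / (4 * z ^+ 2)) =
      2 * z + y ^+ 2 / (2 * z) by field; rewrite gt_eqF.
    (* Arithmetic-geometric mean: 2 z + y^2 / (2 z) is at least 2 y, hence at least y. *)
    have e1 : 2 * z + y ^+ 2 / (2 * z) - 2 * y = (y - 2 * z) ^+ 2 / (2 * z).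
      by field; rewrite gt_eqF.
    have : 0 <= (y - 2 * z) ^+ 2 / (2 * z).
      by rewrite divr_ge0 ?sqr_ge0// mulr_ge0// ltW.
    lra.
  by rewrite mulr_ge0.
- have := integrable_normal_pdf m (Num.sqrt 2 * s) => /(integrableZl _ C).
  by apply.
- apply/measurable_EFinP; apply: measurable_funM; last exact: measurable_normal_pdf.
  by apply: measurableT_comp => //; exact: measurable_funB.
Qed.

Let cvg_expR_sqr (b c : R) : 0 < c ->
  expR (- ((n%:R + b) ^+ 2 / c)) @[n --> \oo] --> (0 : R).
Proof.
move=> c0.
apply: (cvg_comp (fun n : nat => (n%:R + b) ^+ 2 / c) (fun x => expR (- x)) _
  (@cvgr_expR R)).
apply: (cvg_comp (fun n : nat => (n%:R + b) ^+ 2) (fun x => x / c) (G := +oo)).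
  apply: (cvg_comp (fun n : nat => n%:R + b) (fun x => x ^+ 2) (G := +oo)).
    apply: (cvg_comp (fun n : nat => n%:R) (fun x => x + b) (G := +oo)).
      exact: cvgr_idn.
    exact: cvg_addrr.
  exact: cvgr_expr2.
by apply: gt0_cvgMly; rewrite ?invr_gt0//; exact: cvg_id.
Qed.

Let cvg_pdf : pdf n%:R @[n --> \oo] --> (0 : R).
Proof.
rewrite (_ : (fun n => _) = fun n : nat =>
  normal_peak s * expR (- ((n%:R + - m) ^+ 2 / (s ^+ 2 *+ 2)))).
  rewrite -[X in _ --> X](mulr0 (normal_peak s)).
  apply: cvgM; first exact: cvg_cst.
  by apply: cvg_expR_sqr; rewrite mulrn_wgt0// exprn_even_gt0.
by apply/funext => n; rewrite pdfE mulNr.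
Qed.

Let cvg_pdfN : pdf (- n%:R) @[n --> \oo] --> (0 : R).
Proof.
rewrite (_ : (fun n => _) = fun n : nat =>
  normal_peak s * expR (- ((n%:R + m) ^+ 2 / (s ^+ 2 *+ 2)))).
  rewrite -[X in _ --> X](mulr0 (normal_peak s)).
  apply: cvgM; first exact: cvg_cst.
  by apply: cvg_expR_sqr; rewrite mulrn_wgt0// exprn_even_gt0.
by apply/funext => n; rewrite pdfE mulNr -opprD sqrrN.
Qed.

Let bounded_pdf_integrable (f : R -> R) : bounded_measurable f ->
  mu.-integrable [set: R] (EFin \o (fun x => f x * pdf x)).
Proof.
move=> [mf [M fM]].
apply: (@integrableMr _ _ _ mu _ measurableT f (EFin \o pdf)) => //.
  by exists M; split; [exact: num_real|] => N MN x _ /=;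
    rewrite (le_trans (fM x))// ltW.
exact: integrable_normal_pdf.
Qed.

Let mphase (t p : R) : measurable_fun [set: R] (fun x : R => t * (x - m) + p).
Proof.
apply: measurable_funD => //; apply: measurable_funM => //.
exact: measurable_funB.
Qed.

Let is_derive_phase (t p x : R) :
  is_derive x 1 (fun y : R => t * (y - m) + p) t.
Proof.
rewrite (_ : (fun y => _) = fun y : R => t * y + (p - t * m)).
  exact: is_derive_affine.
by apply/funext => y; ring.
Qed.

Let G (p t : R) : R := \int[mu]_x (cos (t * (x - m) + p) * pdf x).
Let dG (p t x : R) : R := - ((x - m) * sin (t * (x - m) + p)) * pdf x.

Let is_derive_integrand (p t x : R) :
  is_derive t 1 (fun u => cos (u * (x - m) + p) * pdf x) (dG p t x).
Proof.
have d1 : is_derive t 1 (fun u : R => u * (x - m) + p) (x - m).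
  rewrite (_ : (fun u => _) = fun u : R => (x - m) * u + p).
    exact: is_derive_affine.
  by apply/funext => u; ring.
rewrite (_ : (fun u => _) = pdf x *: (cos \o (fun u : R => u * (x - m) + p))).
  by apply: is_derive_eq; rewrite /dG /GRing.scale /=; ring.
by apply/funext => u; rewrite mulrC.
Qed.

Let dG_le p t x : `|dG p t x| <= `|x - m| * pdf x.
Proof.
rewrite /dG mulNr normrN normrM (ger0_norm (normal_pdf_ge0 _ _ _)).
rewrite ler_wpM2r ?normal_pdf_ge0// normrM ler_piMr//.
by rewrite ler_norml sin_geN1 sin_le1.
Qed.

Let measurable_dG p t : measurable_fun [set: R] (dG p t).
Proof.
apply: measurable_funM; last exact: measurable_normal_pdf.
apply: measurableT_comp => //; apply: measurable_funM.
  exact: measurable_funB.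
exact: (bounded_measurable_sin _ (mphase t p)).1.
Qed.

Let integrable_dG p t : mu.-integrable [set: R] (EFin \o dG p t).
Proof.
apply: (@le_integrable _ (measurableTypeR R) R mu [set: R] measurableT _ _ _ _
  integrable_xpdf); first by apply/measurable_EFinP; exact: measurable_dG.
move=> x _; rewrite /= lee_fin; apply: le_trans (dG_le _ _ _) _.
exact: ler_norm.
Qed.

(** Gaussian integration by parts: since pdf' = - (x - m) / s^2 pdf, the derivative of sin (t (x -
    m) + p) pdf is t cos (t (x - m) + p) pdf plus [dG] / s^2, and it integrates to 0. *)
Let integral_dG p t : \int[mu]_x dG p t x = - (s ^+ 2 * t * G p t).
Proof.
pose f x := sin (t * (x - m) + p) * pdf x.
pose df x := t * (cos (t * (x - m) + p) * pdf x) + (s ^+ 2)^-1 * dG p t x.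
have fdf (x : R) : is_derive x 1 f (df x).
  have ds : is_derive x 1 (sin \o (fun y : R => t * (y - m) + p))
    (cos (t * (x - m) + p) * t).
    exact: is_derive1_comp (is_derive_sin _) (is_derive_phase t p x).
  apply: (is_derive_eq (is_deriveM ds (is_derive_pdf x))).
  by rewrite /df /dG /GRing.scale /=; field.
have ci : mu.-integrable [set: R]
    (EFin \o (fun x => cos (t * (x - m) + p) * pdf x)).
  by apply: bounded_pdf_integrable; apply: bounded_measurable_cos; exact: mphase.
have cpdf : continuous pdf by exact: continuous_normal_pdf.
have cphase : continuous (fun y : R => t * (y - m) + p).
  exact: is_derive_continuous (is_derive_phase t p).
have bound x : - pdf x <= f x <= pdf x.
  rewrite -ler_norml /f normrM (ger0_norm (normal_pdf_ge0 _ _ _)).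
  by rewrite ler_piMl ?normal_pdf_ge0// ler_norml sin_geN1 sin_le1.
have hi1 : mu.-integrable [set: R]
    (EFin \o (fun x => t * (cos (t * (x - m) + p) * pdf x))).
  exact: (@integrableZl _ (measurableTypeR R) R mu _ measurableT t _ ci).
have hi2 : mu.-integrable [set: R] (EFin \o (fun x => (s ^+ 2)^-1 * dG p t x)).
  exact: (@integrableZl _ (measurableTypeR R) R mu _ measurableT _ _
    (integrable_dG p t)).
have := Rintegral_derive_eq0 f df fdf.
rewrite RintegralD//.
rewrite !RintegralZl// -/(G p t) => h.
suff : t * G p t + (s ^+ 2)^-1 * \int[mu]_x dG p t x = 0.
  move=> /eqP; rewrite addrC addr_eq0 => /eqP e.
  by rewrite -mulrA -mulrN -e mulVKf// expf_neq0.
apply: h.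
- move=> x; apply: cvgD.
    apply: cvgM; first exact: cvg_cst.
    apply: cvgM; last exact: cpdf.
    by apply: continuous_comp; [exact: cphase|exact: continuous_cos].
  apply: cvgM; first exact: cvg_cst.
  apply: cvgM; last exact: cpdf.
  apply: cvgN; apply: cvgM.
    by apply: cvgB; [exact: cvg_id|exact: cvg_cst].
  by apply: continuous_comp; [exact: cphase|exact: continuous_sin].
- exact: (@integrableD _ (measurableTypeR R) R mu _ measurableT _ _ hi1 hi2).
- apply: (@squeeze_cvgr _ _ _ _ (fun n => - pdf n%:R) (fun n => pdf n%:R)) => //.
    by apply: nearW => n; exact: bound.
  by rewrite -[X in _ --> X]oppr0; exact: cvgN.
- apply: (@squeeze_cvgr _ _ _ _ (fun n => - pdf (- n%:R))
    (fun n => pdf (- n%:R))) => //.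
    by apply: nearW => n; exact: bound.
  by rewrite -[X in _ --> X]oppr0; exact: cvgN.
Qed.

(** Differentiation under the integral; the bound |x - m| pdf does not depend on the parameter, so
    any neighbourhood of [t] would serve. *)
Let is_derive_G p (t : R) : is_derive t 1 (G p) (- (s ^+ 2 * t * G p t)).
Proof.
have tt : `]t - 1, t + 1[%classic t by rewrite /= in_itv/=; apply/andP; split; lra.
have d1E (u x : R) : partial1of2 (fun t x : R => cos (t * (x - m) + p) * pdf x) u x =
    dG p u x.
  by rewrite partial1of2E; have := is_derive_integrand p u x => ?; exact: derive_val.
have h1 (u : R) : `]t - 1, t + 1[%classic u -> mu.-integrable [set: R]
    (EFin \o (fun x => cos (u * (x - m) + p) * pdf x)).
  by move=> _; apply: bounded_pdf_integrable; apply: bounded_measurable_cos;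
    exact: mphase.
have h2 (u x : R) : `]t - 1, t + 1[%classic u -> [set: R] x ->
    derivable (fun u : R => cos (u * (x - m) + p) * pdf x) u 1.
  by move=> _ _; have [] := is_derive_integrand p u x.
have h3 (x : R) : 0 <= `|x - m| * pdf x by rewrite mulr_ge0// normal_pdf_ge0.
have h4 (u x : R) : `]t - 1, t + 1[%classic u -> [set: R] x ->
    `|partial1of2 (fun t x : R => cos (t * (x - m) + p) * pdf x) u x| <=
    `|x - m| * pdf x.
  by move=> _ _; rewrite d1E; exact: dG_le.
apply: DeriveDef.
  exact: (derivable_under_integral measurableT tt h1 h2 h3 integrable_xpdf h4).
rewrite -derive1E
  (differentiation_under_integral measurableT tt h1 h2 h3 integrable_xpdf h4).
by rewrite -integral_dG; apply: eq_Rintegral => x _; exact: d1E.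
Qed.

(* G' = - s^2 t G, hence G (t) exp (s^2 t^2 / 2) is constant. *)
Lemma Rintegral_cos_pdf (a p : R) :
  \int[mu]_x (cos (a * (x - m) + p) * pdf x) =
  cos p * expR (- (s ^+ 2 * a ^+ 2 / 2)).
Proof.
pose e (t : R) := expR (s ^+ 2 / 2 * t ^+ 2).
have de (t : R) : is_derive t 1 e (s ^+ 2 * t * e t).
  rewrite (_ : e = expR \o ((s ^+ 2 / 2) *: (id : R -> R) ^+ 2))//.
  by apply: is_derive_eq; rewrite /GRing.scale /= /e !fctE /= expr1 !mulr1; field.
have cst_eq : (G p * e) a = (G p * e) 0.
  apply: is_derive_0_is_cst => t.
  apply: (is_derive_eq (is_deriveM (is_derive_G p t) (de t))).
  by rewrite /GRing.scale /=; ring.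
move: cst_eq; rewrite !fctE /e expr0n/= mulr0 expR0 mulr1.
have -> : G p 0 = cos p.
  rewrite /G; transitivity (\int[mu]_x (cos p * pdf x)).
    by apply: eq_Rintegral => x _; rewrite mul0r add0r.
  rewrite RintegralZl//; last exact: integrable_normal_pdf.
  by rewrite /Rintegral integral_normal_pdf/= mulr1.
move=> <-; rewrite -[RHS]mulrA -expRD.
have -> : s ^+ 2 / 2 * a ^+ 2 + - (s ^+ 2 * a ^+ 2 / 2) = 0 by ring.
by rewrite expR0 mulr1.
Qed.

(** The Radon-Nikodym derivative of the normal law agrees with [pdf] almost everywhere, since both
    have the same integral over every measurable set. *)
Lemma Rintegral_normal_prob (f : R -> R) : bounded_measurable f ->
  \int[normal_prob m s]_x f x = \int[mu]_x (f x * pdf x).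
Proof.
move=> bf; have mf := bf.1; congr fine.
have dom := normal_prob_dominates m s.
have fi : (normal_prob m s).-integrable [set: R] (EFin \o f).
  exact: (@bounded_measurable_integrable _ _ _ (normal_prob m s)).
rewrite -(Radon_Nikodym_change_of_variables dom)//.
apply: ae_eq_integral => //.
- apply: emeasurable_funM; first exact/measurable_EFinP.
  by apply: (measurable_int mu); exact: Radon_Nikodym_integrable.
- by apply: measurable_int (bounded_pdf_integrable _ bf).
- under [X in ae_eq _ _ _ X]eq_fun do rewrite EFinM.
  apply: ae_eqe_mul2l.
  apply: integral_ae_eq => //.
  + exact: Radon_Nikodym_integrable.
  + by apply/measurable_EFinP; exact: measurable_normal_pdf.
  + by move=> E _ mE; rewrite -Radon_Nikodym_integral.
Qed.

Lemma Rintegral_cos_normal_prob (a p : R) :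
  \int[normal_prob m s]_x cos (a * x + p) =
  cos (a * m + p) * expR (- (s ^+ 2 * a ^+ 2 / 2)).
Proof.
rewrite Rintegral_normal_prob.
  rewrite -Rintegral_cos_pdf; apply: eq_Rintegral => x _.
  by congr (cos _ * _); ring.
by apply: bounded_measurable_cos; apply: measurable_funD.
Qed.

End NormalCosine.

(** * First and second moments from the cosine transform *)

Section Moments.
Context {R : realType} {d : measure_display} {T : measurableType d}.

(** The mean value theorem gives sin x - x = (cos c - 1) x with c between 0 and x, and 1 - cos c = 2
    sin (c / 2)^2 <= c for c > 0. This crude order suffices for an error O(1 / n) in the truncation
    below. *)
Let norm_sin_sub_le (x : R) : `|sin x - x| <= x ^+ 2.
Proof.
wlog x0 : x / 0 < x => [hwlog|].
  have [/hwlog//|] := ltP 0 x; rewrite le_eqVlt => /predU1P[->|x0].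
    by rewrite sin0 subr0 normr0 expr0n.
  rewrite -sqrrN -normrN opprB -[X in X - _]opprK addrC.
  by rewrite -sinN; apply: hwlog; lra.
have [] := @MVT _ sin cos 0 x x0 (fun y _ => is_derive_sin y).
  by apply: continuous_subspaceT; exact: continuous_sin.
move=> c; rewrite in_itv/= => /andP[c0 cx]; rewrite sin0 !subr0 => ->.
rewrite -[X in _ - X]mul1r -mulrBl normrM (gtr0_norm x0) expr2.
rewrite ler_pM2r//; apply: le_trans (ltW cx).
rewrite distrC ger0_norm ?subr_ge0 ?cos_le1//.
have -> : 1 - cos c = 2 * sin (c / 2) ^+ 2.
  by rewrite [in LHS](splitr c) cosD -!expr2 cos2sin2; ring.
have s1 : `|sin (c / 2)| <= 1 by rewrite ler_norml sin_geN1 sin_le1.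
have := norm_sin_le (c / 2); rewrite [in leRHS]gtr0_norm ?divr_gt0// => sc.
rewrite -real_normK ?num_real// expr2.
have := ler_pM (normr_ge0 _) (normr_ge0 _) s1 sc.
lra.
Qed.

(** A bounded truncation of [V] with |u| <= |V|. With N = n + 1, the factor 2 makes its square
    exactly 2 N^2 (1 - cos (V / N)), so its first two moments are values of the cosine transform. *)
Let u (V : T -> R) (n : nat) (w : T) : R :=
  2 * n.+1%:R * sin (V w / (2 * n.+1%:R)).

Let n0 (n : nat) : 0 < 2 * n.+1%:R :> R. Proof. by rewrite mulr_gt0. Qed.

Let cvg_u V w : u V n w @[n --> \oo] --> V w.
Proof.
have h : V w ^+ 2 / 2 / n.+1%:R @[n --> \oo] --> (0 : R).
  exact: cvg_harmonic_mul.
apply: (@squeeze_cvgr _ _ _ _ (fun n : nat => V w - V w ^+ 2 / 2 / n.+1%:R)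
  (fun n : nat => V w + V w ^+ 2 / 2 / n.+1%:R)).
- apply: nearW => n; rewrite -ler_distl.
  have := norm_sin_sub_le (V w / (2 * n.+1%:R)).
  move=> /(ler_wpM2l (ltW (n0 n))).
  rewrite -{1}(gtr0_norm (n0 n)) -normrM mulrBr -/(u V n w).
  rewrite mulrCA divff ?gt_eqF// mulr1 => /le_trans; apply.
  rewrite [leLHS](_ : _ = V w ^+ 2 / 2 / n.+1%:R)//.
  by have := ltr0Sn R n; move: (n.+1%:R) => N N0; field; rewrite gt_eqF.
- by rewrite -[X in _ --> X]subr0; apply: cvgB => //; exact: cvg_cst.
- by rewrite -[X in _ --> X]addr0; apply: cvgD => //; exact: cvg_cst.
Qed.

Let norm_u_le V n w : `|u V n w| <= `|V w|.
Proof.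
rewrite /u normrM (gtr0_norm (n0 n)).
rewrite [leLHS]mulrC -ler_pdivlMr//.
have := norm_sin_le (V w / (2 * n.+1%:R)).
by rewrite normrM normfV (gtr0_norm (n0 n)).
Qed.

Variables (P : probability T R) (V : T -> R) (v : R).
Hypotheses (mV : measurable_fun [set: T] V).
Hypothesis cosV : forall t p,
  \int[P]_w cos (t * V w + p) = cos p * expR (- (v * t ^+ 2 / 2)).

Let bu n : bounded_measurable (u V n).
Proof.
apply: (bounded_measurableM (cst _)); first exact: bounded_measurable_cst.
by apply: bounded_measurable_sin; exact: measurable_funM.
Qed.

Let integral_u n : \int[P]_w u V n w = 0.
Proof.
rewrite bounded_RintegralZl; last first.
  by apply: bounded_measurable_sin; exact: measurable_funM.
transitivity (2 * n.+1%:R *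
    \int[P]_w cos ((2 * n.+1%:R)^-1 * V w + - (pi / 2))).
  congr (_ * _); apply: eq_Rintegral => w _.
  by rewrite [in RHS]cosBpihalf mulrC.
by rewrite cosV cosN cos_pihalf mul0r mulr0.
Qed.

Let integral_sqr_u n : \int[P]_w (u V n w ^+ 2) =
  2 * n.+1%:R ^+ 2 * (1 - expR (- (v / (2 * n.+1%:R ^+ 2)))).
Proof.
transitivity (\int[P]_w (2 * n.+1%:R ^+ 2 *
    (1 - cos (n.+1%:R^-1 * V w + 0)))).
  apply: eq_Rintegral => w _; rewrite /u exprMn addr0.
  have -> : n.+1%:R^-1 * V w = V w / (2 * n.+1%:R) + V w / (2 * n.+1%:R).
    by have := ltr0Sn R n; move: (n.+1%:R) => N N0; field; rewrite gt_eqF.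
  by rewrite cosD -!expr2 cos2sin2; ring.
have b1 := bounded_measurable_cst (T := T) (1 : R).
have bc : bounded_measurable (fun w => cos (n.+1%:R^-1 * V w + 0)).
  by apply: bounded_measurable_cos; apply: measurable_funD => //; exact: measurable_funM.
rewrite bounded_RintegralZl; last first.
  have := bounded_measurableD _ _ b1 (bounded_measurableM _ _
    (bounded_measurable_cst (-1)) bc).
  by congr bounded_measurable; apply/funext => w /=; rewrite mulN1r.
rewrite (bounded_RintegralB P (cst 1))// cosV cos0 mul1r.
have P1 : fine (P [set: T]) = 1 by rewrite probability_setT.
rewrite Rintegral_cst// [fine _]P1 mulr1; congr (_ * (1 - expR (- _))).
by have := ltr0Sn R n; move: (n.+1%:R) => N N0; field; rewrite gt_eqF.
Qed.

Let integral_sqr_u_le n : \int[P]_w (u V n w ^+ 2) <= v.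
Proof.
rewrite integral_sqr_u.
have := expR_ge1Dx (- (v / (2 * n.+1%:R ^+ 2))).
have c0 : 0 < 2 * n.+1%:R ^+ 2 :> R by rewrite mulr_gt0// exprn_gt0.
move: (2 * _) c0 => c c0 h.
rewrite mulrC -ler_pdivlMr//; lra.
Qed.

Hypothesis v0 : 0 <= v.

(** With x = v / (2 N^2), the moment is 2 N^2 (1 - exp (- x)), squeezed by x - x^2 <= 1 - exp (- x)
    <= x. *)
Let cvg_integral_sqr_u : \int[P]_w (u V n w ^+ 2) @[n --> \oo] --> v.
Proof.
apply: (@squeeze_cvgr _ _ _ _
  (fun n : nat => v - (v ^+ 2 / 2 / n.+1%:R) / n.+1%:R) (cst v)); last 2 first.
- rewrite -[X in _ --> X]subr0; apply: cvgB; first exact: cvg_cst.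
  rewrite -(mulr0 (0 : R)); apply: cvgM; last exact: cvg_harmonic.
  exact: cvg_harmonic_mul.
- exact: cvg_cst.
apply: nearW => n; rewrite integral_sqr_u_le andbT integral_sqr_u.
have c0 : 0 < 2 * n.+1%:R ^+ 2 :> R by rewrite mulr_gt0// exprn_gt0.
have -> : v ^+ 2 / 2 / n.+1%:R / n.+1%:R = v ^+ 2 / (2 * n.+1%:R ^+ 2) :> R.
  by have := ltr0Sn R n; move: (n.+1%:R) => N N0; field; rewrite gt_eqF.
move: (2 * _) c0 => c c0.
have x0 : 0 <= v / c by rewrite divr_ge0// ltW.
(* From exp x >= 1 + x and (1 - x + x^2)(1 + x) = 1 + x^3 >= 1. *)
have h : expR (- (v / c)) <= 1 - v / c + (v / c) ^+ 2.
  rewrite expRN -[leLHS]mul1r ler_pdivrMr ?expR_gt0//.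
  have := expR_ge1Dx (v / c); move: (v / c) x0 (expR _) => x x0 e he.
  have p0 : 0 <= 1 - x + x ^+ 2 by have := sqr_ge0 (x - 1 / 2); lra.
  have := ler_wpM2l p0 he.
  have : 0 <= x ^+ 3 by rewrite exprn_ge0.
  lra.
have := ler_wpM2l (ltW c0) h.
have -> : c * (1 - v / c + (v / c) ^+ 2) = c - v + v ^+ 2 / c.
  by field; rewrite gt_eqF.
lra.
Qed.

(* Fatou's lemma with u_n = 2 n sin (V / (2 n)), whose second moment is given by
   the cosine transform. *)
Lemma sqr_integrable : P.-integrable [set: T] (EFin \o (fun w => V w ^+ 2)).
Proof.
apply/integrableP; split.
  by apply/measurable_EFinP; exact: measurable_funX.
apply: (@le_lt_trans _ _ v%:E); last exact: ltry.
have := @fatou _ T R P [set: T] measurableT (fun n w => (u V n w ^+ 2)%:E).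
have -> : (\int[P]_w limn_einf (fun n => (u V n w ^+ 2)%:E) =
    \int[P]_w `|(V w ^+ 2)%:E|)%E.
  apply: eq_integral => w _ /=.
  have h : (u V n w ^+ 2)%:E @[n --> \oo] --> (V w ^+ 2)%:E.
    apply: cvg_EFin; first exact: nearW.
    by rewrite expr2; apply: cvgM; exact: cvg_u.
  by have [-> _] := cvg_limn_einf_sup h; rewrite ger0_norm ?sqr_ge0.
move=> /(_ _ _)/le_trans; apply.
- by move=> n; apply/measurable_EFinP; apply: measurable_funX; exact: (bu n).1.
- by move=> n w _; rewrite lee_fin sqr_ge0.
- have /cvg_limn_einf_sup[-> _] : (\int[P]_w (u V n w ^+ 2)%:E)%E @[n --> \oo]
      --> v%:E; last by [].
  apply: cvg_EFin; last exact: cvg_integral_sqr_u.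
  apply: nearW => n; apply: integrable_fin_num => //.
  apply: (@bounded_measurable_integrable _ _ _ P (fun w => u V n w ^+ 2)).
  exact: (bounded_measurableM _ _ (bu n) (bu n)).
Qed.

(** Square integrability comes first: it makes |V| <= 1 + V^2 and V^2 integrable dominating
    functions, under which the moments of the truncations pass to the limit. *)
Lemma moments_of_cos : [/\ P.-integrable [set: T] (EFin \o V),
  \int[P]_w V w = 0 & \int[P]_w (V w ^+ 2) = v].
Proof.
have V2 := sqr_integrable.
have Vi : P.-integrable [set: T] (EFin \o V).
  apply: (@le_integrable _ T R P _ measurableT _
    (EFin \o (cst 1 \+ (fun w => V w ^+ 2)))).
  - exact/measurable_EFinP.
  - move=> w _ /=; rewrite lee_fin [leRHS]ger0_norm; last first.
      by rewrite addr_ge0// sqr_ge0.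
    rewrite -[in leRHS]real_normK ?num_real//.
    by have := sqr_ge0 (`|V w| - 1 / 2); lra.
  - apply: (integrableD measurableT (f := EFin \o cst 1) (g := EFin \o _)) => //.
    exact/bounded_measurable_integrable/bounded_measurable_cst.
have iV : P.-integrable [set: T] (EFin \o (fun w => `|V w|)).
  exact: integrable_norm.
split => //.
- have [|||||_ c1] := @cvg_Rintegral _ _ _ P [set: T] (u V) V (fun w => `|V w|).
  + by [].
  + by move=> n; exact: (bu n).1.
  + by [].
  + by move=> w _; exact: cvg_u.
  + by move=> n w _; exact: norm_u_le.
  suff c2 : (\int[P]_w u V n w) @[n --> \oo] --> (0 : R).
    exact: (cvg_unique _ c1 c2).
  rewrite (_ : (fun n => _) = cst 0); first exact: cvg_cst.
  by apply/funext => n; exact: integral_u.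
- have [|||||_ c1] := @cvg_Rintegral _ _ _ P [set: T] (fun n w => u V n w ^+ 2)
    (fun w => V w ^+ 2) (fun w => V w ^+ 2).
  + by [].
  + by move=> n; apply: measurable_funX; exact: (bu n).1.
  + by [].
  + by move=> w _; rewrite expr2; apply: cvgM; exact: cvg_u.
  + move=> n w _; rewrite normrX -[leRHS]real_normK ?num_real//.
    by rewrite lerXn2r ?nnegrE.
  exact: (cvg_unique _ c1 cvg_integral_sqr_u).
Qed.

End Moments.

(** * Riemann sums *)

Section RiemannSums.
Context {R : realType}.
Notation mu := (@lebesgue_measure R).

Lemma segment_uniform_continuity (f : R -> R) (a b e : R) : 0 < e ->
  continuous f -> exists2 d, 0 < d &
    forall x y, x \in `[a, b] -> `|x - y| < d -> `|f x - f y| < e.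
Proof.
move=> e0 cf.
pose Q (d x : R) := forall y, `|x - y| < d -> `|f x - f y| < e.
have : \forall d \near 0^'+, `[a, b]%classic `<=` Q d.
  apply: (compact_near_coveringP _).1 => //; first exact: segment_compact.
  move=> x _.
  have /cvgrPdist_lt/(_ (e / 2)) := cf x.
  rewrite divr_gt0// => /(_ isT)[d /= d0 xd].
  exists (ball x (d / 2), [set r : R | r < d / 2]) => /=.
    split; first by apply: nbhsx_ballx; rewrite divr_gt0.
    by apply: nbhs_right_lt; rewrite divr_gt0.
  move=> [x' r] [/= xx' rd] y x'y.
  have fx' : `|f x - f x'| < e / 2.
    by apply: xd; apply: lt_trans xx' _; lra.
  have fy : `|f x - f y| < e / 2.
    apply: xd => /=; rewrite (le_lt_trans (ler_distD x' _ _))//.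
    by move: xx'; rewrite /ball /= => xx'; lra.
  rewrite (le_lt_trans (ler_distD (f x) _ _))// distrC; lra.
move=> h.
near (0 : R)^'+ => d.
exists d => //.
have : `[a, b]%classic `<=` Q d by near: d.
by move=> ab x y xab; exact: ab.
Unshelve. all: by end_near. Qed.

Lemma continuous_itv_integrable (f : R -> R) (a b : R) : continuous f ->
  mu.-integrable `[a, b] (EFin \o f).
Proof.
move=> cf; apply: continuous_compact_integrable; first exact: segment_compact.
exact: continuous_subspaceT.
Qed.

Lemma cvg_riemann_sum (f : R -> R) (a b : R) : a <= b -> continuous f ->
  (b - a) / n.+1%:R *
    \sum_(k < n.+1) f (a + (b - a) * (k.+1%:R / n.+1%:R)) @[n --> \oo] -->
  \int[mu]_(x in `[a, b]) f x.
Proof.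
move=> ab cf; apply/cvgrPdist_le => e e0.
have ba0 : 0 <= b - a by rewrite subr_ge0.
(* The added 1 keeps the denominator positive when a = b. *)
pose e' := e / (b - a + 1).
have e'0 : 0 < e' by rewrite divr_gt0//; lra.
have [d d0 fd] := segment_uniform_continuity f a b e' e'0 cf.
have : \forall n \near \oo, (b - a) / n.+1%:R < d.
  exact: (cvgr_lt (0 : R) (cvg_harmonic_mul (b - a)) _ d0).
apply: filterS => n; set N : R := n.+1%:R; set h := (b - a) / N => hd.
have N0 : 0 < N by rewrite /N.
have h0 : 0 <= h by rewrite divr_ge0// ltW.
have hN : h * N = b - a by rewrite divfK// gt_eqF.
pose x (k : nat) := a + h * k%:R.
have xS k : x k.+1 = x k + h by rewrite /x -natr1; ring.
have xab k : (k <= n.+1)%N -> a <= x k <= b.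
  move=> kn; apply/andP; split; first by rewrite lerDl mulr_ge0.
  rewrite -lerBrDl -hN ler_wpM2l// /N ler_nat//.
have part k : (k <= n.+1)%N ->
    `|\int[mu]_(y in `[a, x k]) f y - h * \sum_(i < k) f (x i.+1)| <=
    k%:R * (h * e').
  elim: k => [_|k IH kn].
    rewrite big_ord0 mulr0 subr0 mul0r /x mulr0 addr0 set_itv1 Rintegral_set1.
    by rewrite normr0.
  have {}IH := IH (ltnW kn).
  have /andP[ax xb] := xab _ (ltnW kn); have /andP[ax' xb'] := xab _ kn.
  have xx : x k <= x k.+1 by rewrite xS lerDl.
  have := @Rintegral_itvB R f (BLeft a) (BRight (x k.+1)) (x k)
    (continuous_itv_integrable f a (x k.+1) cf).
  rewrite !bnd_simp => /(_ ax xx) split_int.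
  have io : mu.-integrable `]x k, x k.+1] (EFin \o f).
    apply: integrableS (continuous_itv_integrable f (x k) (x k.+1) cf) => //.
    exact: subset_itv_oc_cc.
  have ic : mu.-integrable `]x k, x k.+1] (EFin \o cst (f (x k.+1))).
    apply: integrableS (continuous_itv_integrable _ (x k) (x k.+1)
      (fun _ => cvg_cst (f (x k.+1)))) => //.
    exact: subset_itv_oc_cc.
  have mux : fine (mu `]x k, x k.+1]) = h.
    rewrite lebesgue_measure_itv /= lte_fin.
    by case: ltP => [_|xx'] /=; [rewrite xS; ring|rewrite xS in xx'; lra].
  have piece : `|\int[mu]_(y in `]x k, x k.+1]) f y - h * f (x k.+1)| <= h * e'.
    have -> : h * f (x k.+1) = \int[mu]_(y in `]x k, x k.+1]) f (x k.+1).
      by rewrite Rintegral_cst// [fine _]mux mulrC.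
    rewrite -RintegralB//.
    have ib : mu.-integrable `]x k, x k.+1]
        (EFin \o (fun y => f y - f (x k.+1))).
      exact: (@integrableB _ (measurableTypeR R) R mu _ _ _ _ io ic).
    apply: le_trans (le_normr_Rintegral _ ib) _ => //.
    have -> : h * e' = \int[mu]_(y in `]x k, x k.+1]) e'.
      by rewrite Rintegral_cst// [fine _]mux mulrC.
    apply: le_Rintegral => //.
    - exact: integrable_norm.
    - apply: integrableS (continuous_itv_integrable _ (x k) (x k.+1)
        (fun _ => cvg_cst e')) => //.
      exact: subset_itv_oc_cc.
    move=> y; rewrite /= in_itv/= => /andP[xy yx]; apply/ltW/fd.
      by rewrite in_itv/=; apply/andP; split; lra.
    rewrite distrC ger0_norm ?subr_ge0//; rewrite xS in yx *; lra.
  rewrite big_ord_recr /= mulrDr.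
  have -> : \int[mu]_(y in `[a, x k.+1]) f y =
      \int[mu]_(y in `[a, x k]) f y + \int[mu]_(y in `]x k, x k.+1]) f y.
    by rewrite -split_int; ring.
  rewrite opprD addrACA (le_trans (ler_normD _ _))//.
  by rewrite -natr1 mulrDl mul1r lerD.
have := part n.+1 (leqnn _).
have -> : x n.+1 = b by rewrite /x hN; ring.
have -> : \sum_(i < n.+1) f (x i.+1) =
    \sum_(k < n.+1) f (a + (b - a) * (k.+1%:R / N)).
  by apply: eq_bigr => i _; congr f; rewrite /x /h; ring.
move=> /le_trans; apply.
rewrite mulrA -/N (mulrC N) hN /e'.
rewrite mulrA ler_pdivrMr; last by lra.
rewrite mulrC ler_wpM2l// ?ltW//; lra.
Qed.

End RiemannSums.

(** * Brownian increments *)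

Section BrownianIncrements.
Context {R : realType} {d : measure_display} {T : measurableType d}.
Variables (P : probability T R) (W : R -> T -> R).
Hypothesis hW : standard_brownian P W.

Let measurable_increment s t : 0 <= s -> 0 <= t ->
  measurable_fun [set: T] (fun w => W t w - W s w).
Proof. by move=> s0 t0; apply: measurable_funB; exact: (bm_measurable hW). Qed.

(** The case s = t is included because the grids collapse to one point when r = s or r = u. *)
Lemma cos_increment (s t c p : R) : 0 <= s -> s <= t ->
  \int[P]_w cos (c * (W t w - W s w) + p) =
  cos p * expR (- (c ^+ 2 * (t - s) / 2)).
Proof.
move=> s0; rewrite le_eqVlt => /predU1P[<-|st].
  have P1 : fine (P [set: T]) = 1 by rewrite probability_setT.
  rewrite subrr mulr0 mul0r oppr0 expR0 mulr1.
  transitivity (\int[P]_w cos p); last by rewrite Rintegral_cst// [fine _]P1 mulr1.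
  by apply: eq_Rintegral => w _; rewrite subrr mulr0 add0r.
have t0 : 0 <= t by rewrite (le_trans s0)// ltW.
have mX := measurable_increment s t s0 t0.
have sd0 : Num.sqrt (t - s) != 0 by rewrite gt_eqF// sqrtr_gt0 subr_gt0.
have bcos : bounded_measurable (fun x : R => cos (c * x + p)).
  by apply: bounded_measurable_cos; exact: measurable_funD.
have := Rintegral_cos_normal_prob 0 _ sd0 c p.
rewrite mulr0 add0r sqr_sqrtr ?subr_ge0 1?ltW// (mulrC (t - s)) => <-.
congr fine.
rewrite -(@integral_law R _ _ T (measurableTypeR R) P _ mX
  (fun x => (cos (c * x + p))%:E)); last 2 first.
- by apply/measurable_EFinP; exact: bcos.1.
- apply: (@bounded_measurable_integrable _ _ _ P
    (fun w => cos (c * (W t w - W s w) + p))).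
  apply: bounded_measurable_cos; apply: measurable_funD => //.
  exact: measurable_funM.
by apply: eq_measure_integral => A mA _; exact: (bm_normal hW).
Qed.

Let increments_independent (n : nat) (t : nat -> R) :
  0 <= t 0%N -> nondecreasing_seq t ->
  let V := fun w => [tuple W (t i.+1) w - W (t i) w | i < n] in
  let X := fun w => W (t n.+1) w - W (t n) w in
  measurable_fun [set: T] V /\
  forall A B, measurable A -> measurable B ->
    P (V @^-1` A `&` X @^-1` B) = (P (V @^-1` A) * P (X @^-1` B))%E.
Proof.
move=> t0 ndt V X.
have tge0 k : 0 <= t k by rewrite (le_trans t0)// ndt.
have mV : measurable_fun [set: T] V.
  apply/measurable_fun_tnthP => i.
  rewrite (_ : _ \o _ = fun w => W (t i.+1) w - W (t i) w).
    exact: measurable_increment.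
  by apply/funext => w /=; rewrite tnth_mktuple.
have mX : measurable_fun [set: T] X by exact: measurable_increment.
split=> // A B mA mB.
apply: factor_tuple => //; first by rewrite -[X in measurable X]setTI; exact: mX.
move=> a.
(* An orthant for the first [n] increments together with a set [D] for the last one is a rectangle.
   The choice of the whole line for [D] gives the product formula for the first [n] alone, and
   dividing the family in two follows. *)
pose C D (i : 'I_n.+1) : set R :=
  if unlift ord_max i is Some j then `]a j, +oo[%classic else D.
have mC D : measurable D -> forall i, measurable (C D i).
  by move=> mD i; rewrite /C; case: (unlift _ _).
have bm (j : 'I_n) : bump n j = j by rewrite /bump leqNgt ltn_ord add0n.
have CE D : orthant (fun i w => tnth (V w) i) a `&` X @^-1` D =
    \bigcap_(i in [set: 'I_n.+1])
      ((W (t i.+1) \- W (t i)) @^-1` C D i).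
  apply/seteqP; split => [w [Vw Xw] i _|w Cw].
    rewrite /= /C; case: (unliftP ord_max i) => [j ->|->] //.
    by have := Vw j; rewrite /= in_itv/= andbT tnth_mktuple bm.
  split => [i|].
    have := Cw (lift ord_max i) I.
    by rewrite /= /C liftK /= in_itv/= andbT tnth_mktuple bm.
  by have := Cw ord_max I; rewrite /= /C unlift_none.
have prodE D : measurable D -> P (orthant (fun i w => tnth (V w) i) a `&` X @^-1` D) =
    ((\prod_(i < n) P ((W (t i.+1) \- W (t i))%R @^-1` `]a i, +oo[%classic)) *
      P (X @^-1` D))%E.
  move=> mD; rewrite CE (bm_independent hW t0 ndt (mC D mD)).
  rewrite big_ord_recr /=; congr (_ * _)%E.
    apply: eq_bigr => i _.
    have -> : widen_ord (leqnSn n) i = lift ord_max i.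
      by apply/val_inj; rewrite /= bm.
    by rewrite /C liftK.
  by rewrite /C unlift_none.
have := prodE _ (@measurableT _ R).
rewrite preimage_setT setIT probability_setT mule1 => ->.
exact: prodE.
Qed.

(** Induction that splits off the last increment by cos (x + y) = cos x cos y - sin x sin y. The
    sine term vanishes because the last increment is symmetric; writing sines as cosines of phase -
    pi / 2 requires the induction hypothesis for every phase. *)
Lemma cos_increments (n : nat) (c t : nat -> R) (p : R) :
  0 <= t 0%N -> nondecreasing_seq t ->
  \int[P]_w cos (\sum_(i < n) c i * (W (t i.+1) w - W (t i) w) + p) =
  cos p * expR (- ((\sum_(i < n) c i ^+ 2 * (t i.+1 - t i)) / 2)).
Proof.
move=> t0 ndt; elim: n p => [|n IH] p.
  have P1 : fine (P [set: T]) = 1 by rewrite probability_setT.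
  rewrite big_ord0 mul0r oppr0 expR0 mulr1.
  transitivity (\int[P]_w cos p); last by rewrite Rintegral_cst// [fine _]P1 mulr1.
  by apply: eq_Rintegral => w _; rewrite big_ord0 add0r.
have tge0 k : 0 <= t k by rewrite (le_trans t0)// ndt.
have [mV VX] := increments_independent n t t0 ndt.
set V := fun w => _ in mV VX.
set X := fun w => _ in VX.
have mX : measurable_fun [set: T] X by exact: measurable_increment.
pose f (q : R) (x : n.-tuple R) := cos (\sum_(i < n) c i * tnth x i + q).
pose g (q : R) (x : R) := cos (c n * x + q).
have bf q : bounded_measurable (f q).
  apply: bounded_measurable_cos; apply: measurable_funD => //.
  apply: measurable_sum => i; apply: measurable_funM => //.
  exact: measurable_tnth.
have bg q : bounded_measurable (g q).
  by apply: bounded_measurable_cos; exact: measurable_funD.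
have bfV q : bounded_measurable (f q \o V).
  split; first by apply: measurableT_comp => //; exact: (bf q).1.
  by have [_ [M fM]] := bf q; exists M => w /=.
have bgX q : bounded_measurable (g q \o X).
  split; first by apply: measurableT_comp => //; exact: (bg q).1.
  by have [_ [M gM]] := bg q; exists M => w /=.
have VE q w : f q (V w) =
    cos (\sum_(i < n) c i * (W (t i.+1) w - W (t i) w) + q).
  by congr (cos (_ + _)); apply: eq_bigr => i _; rewrite tnth_mktuple.
have fE q : \int[P]_w f q (V w) =
    cos q * expR (- ((\sum_(i < n) c i ^+ 2 * (t i.+1 - t i)) / 2)).
  by rewrite -IH; apply: eq_Rintegral => w _; exact: VE.
have gE q : \int[P]_w g q (X w) =
    cos q * expR (- (c n ^+ 2 * (t n.+1 - t n) / 2)).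
  by rewrite -(cos_increment (t n))// ndt.
have fgE q r : \int[P]_w (f q (V w) * g r (X w)) =
    \int[P]_w f q (V w) * \int[P]_w g r (X w).
  apply: (independent_Rintegral P V X mV mX VX) => //; first exact: (bf q).1.
  exact: bounded_measurable_integrable.
transitivity (\int[P]_w (f p (V w) * g 0 (X w) -
    f (p - pi / 2) (V w) * g (- (pi / 2)) (X w))).
  apply: eq_Rintegral => w _; rewrite !VE big_ord_recr /= /g.
  rewrite -/(X w); set S := \sum_(i < n) _.
  rewrite addr0 addrA !cosBpihalf -cosD; congr cos; ring.
have bfg q r : bounded_measurable (fun w => f q (V w) * g r (X w)).
  exact: (bounded_measurableM _ _ (bfV q) (bgX r)).
rewrite (bounded_RintegralB P _ _ (bfg _ _) (bfg _ _)) !fgE !fE !gE.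
rewrite cosN cos_pihalf mul0r mulr0 subr0 cos0 mul1r -[LHS]mulrA -expRD.
by rewrite big_ord_recr /=; congr (_ * expR _); ring.
Qed.

End BrownianIncrements.

Section Paths.
Context {R : realType}.

Let cvg_comp_max0 (f : R -> R) : {within `[0, +oo[, continuous f} ->
  continuous (fun q : R => f (Num.max 0 q)).
Proof.
move=> /subspace_continuousP cf q.
have A0 x : `[0, +oo[%classic (Num.max 0 x : R).
  by rewrite /= in_itv/= andbT le_max lexx.
have cmax : Num.max (0 : R) x @[x --> q] --> (Num.max 0 q : R).
  by apply: continuous_max; [exact: cvg_cst|exact: cvg_id].
apply: cvg_comp (cf _ (A0 q)) => U /= hU.
exact: (@filterS _ (nbhs q) _ _ _ (fun x xU => xU (A0 x)) (cmax _ hU)).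
Qed.

Context {T : Type}.

(* Paths are only continuous on [0, +oo[; freezing them at negative times makes
   them continuous on the whole line. *)
Definition extend_path (W : R -> T -> R) (q : R) (w : T) : R :=
  W (Num.max 0 q) w.

Lemma extend_pathE W q w : 0 <= q -> extend_path W q w = W q w.
Proof. by move=> q0; rewrite /extend_path max_r. Qed.

Lemma extend_path_continuous W w :
  {within `[0, +oo[, continuous (fun q : R => W q w)} ->
  continuous (fun q : R => extend_path W q w).
Proof. exact: cvg_comp_max0. Qed.

Lemma levy_triple_extend W s t w : 0 <= s -> s <= t ->
  levy_triple (extend_path W) s t w = levy_triple W s t w.
Proof.
move=> s0 st; have t0 := le_trans s0 st.
have bE q : q \in `[s, t]%classic ->
    bridge (extend_path W) s t q w = bridge W s t q w.
  rewrite inE /= in_itv/= => /andP[sq _].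
  by rewrite /bridge !extend_pathE// (le_trans s0).
rewrite /levy_triple !extend_pathE//; congr [tuple _; _; _].
- by congr (_ * _); apply: eq_Rintegral => q /bE ->.
- by congr (_ * _); apply: eq_Rintegral => q /bE ->.
Qed.

End Paths.

(** * The areas as Wiener integrals *)

Section PathAreas.
Context {R : realType} {T : Type}.
Notation mu := (@lebesgue_measure R).
Variables (W : R -> T -> R) (w : T).
Hypothesis cW : continuous (fun q : R => W q w).

Let I0 (s t : R) : R := \int[mu]_(q in `[s, t]) W q w.
Let I1 (s t : R) : R := \int[mu]_(q in `[s, t]) (q * W q w).

Let cqW : continuous (fun q : R => q * W q w).
Proof. by move=> q; apply: cvgM; [exact: cvg_id|exact: cW]. Qed.

Let continuous_quadratic (c2 c3 c4 : R) :
  continuous (fun q : R => c2 + c3 * q + c4 * q ^+ 2).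
Proof.
move=> q; apply: cvgD; last first.
  apply: cvgM; first exact: cvg_cst.
  by rewrite expr2; under eq_fun do rewrite expr2; apply: cvgM; exact: cvg_id.
apply: cvgD; first exact: cvg_cst.
by apply: cvgM; [exact: cvg_cst|exact: cvg_id].
Qed.

Let Rintegral_quadratic (c2 c3 c4 s t : R) : s <= t ->
  \int[mu]_(q in `[s, t]) (c2 + c3 * q + c4 * q ^+ 2) =
  c2 * (t - s) + c3 * (t ^+ 2 - s ^+ 2) / 2 + c4 * (t ^+ 3 - s ^+ 3) / 3.
Proof.
rewrite le_eqVlt => /predU1P[<-|st].
  by rewrite set_itv1 Rintegral_set1 !subrr !mulr0 !mul0r !addr0.
pose F : R -> R := (c2 *: (id : R -> R)) + ((c3 / 2) *: (id : R -> R) ^+ 2) +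
  ((c4 / 3) *: (id : R -> R) ^+ 3).
have dF (x : R) : is_derive x 1 F (c2 + c3 * x + c4 * x ^+ 2).
  have d1 := is_derive_id x (1 : R).
  apply: (is_derive_eq (is_deriveD (is_deriveD (is_deriveZ c2 d1)
    (is_deriveZ (c3 / 2) (is_deriveX 2 d1)))
    (is_deriveZ (c4 / 3) (is_deriveX 3 d1)))).
  by rewrite /GRing.scale /= !mulr1 expr1; field.
have cF : continuous F.
  by move=> x; apply/differentiable_continuous/derivable1_diffP; case: (dF x).
rewrite /Rintegral (@continuous_FTC2 R _ F)//=.
- by rewrite /F !fctE /GRing.scale /=; field.
- exact/continuous_subspaceT/continuous_quadratic.
- split => [x _||].
  + by case: (dF x).
  + by apply: cvg_at_right_filter; exact: cF.
  + by apply: cvg_at_left_filter; exact: cF.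
- by move=> x _; rewrite derive1E; exact: derive_val.
Qed.

(** The integrands of both areas have this shape: the bridge is affine in [W q w] and [q], and the
    weight in the second area is affine in [q]. *)
Let Rintegral_path (c0 c1 c2 c3 c4 s t : R) : s <= t ->
  \int[mu]_(q in `[s, t])
    (c0 * W q w + c1 * (q * W q w) + (c2 + c3 * q + c4 * q ^+ 2)) =
  c0 * I0 s t + c1 * I1 s t +
  (c2 * (t - s) + c3 * (t ^+ 2 - s ^+ 2) / 2 + c4 * (t ^+ 3 - s ^+ 3) / 3).
Proof.
move=> st.
have cZ (c : R) (f : R -> R) : continuous f -> continuous (fun q : R => c * f q).
  by move=> cf q; apply: cvgM; [exact: cvg_cst|exact: cf].
have ii f := continuous_itv_integrable f s t.
have cW0 : continuous (fun q : R => c0 * W q w) by exact: (cZ _ _ cW).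
have cW1 : continuous (fun q : R => c1 * (q * W q w)) by exact: (cZ _ _ cqW).
rewrite RintegralD//; last 2 first.
- by apply: ii => q; apply: cvgD; [exact: cW0|exact: cW1].
- exact/ii/continuous_quadratic.
rewrite Rintegral_quadratic// RintegralD//; last 2 first.
- exact: ii.
- exact: ii.
by rewrite !RintegralZl//; exact: ii.
Qed.

Let I_refl s : I0 s s = 0 /\ I1 s s = 0.
Proof. by rewrite /I0 /I1 set_itv1 !Rintegral_set1. Qed.

Let Rintegral_cat (f : R -> R) (s r u : R) : s <= r -> r <= u ->
  continuous f -> \int[mu]_(q in `[s, u]) f q =
  \int[mu]_(q in `[s, r]) f q + \int[mu]_(q in `[r, u]) f q.
Proof.
move=> sr ru cf.
have := @Rintegral_itvB R f (BLeft s) (BRight u) r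
  (continuous_itv_integrable f s u cf).
rewrite !bnd_simp => /(_ sr ru) h.
rewrite -[X in _ = _ + X]Rintegral_itv_obnd_cbnd -?h; first by ring.
apply: integrableS (continuous_itv_integrable f r u cf) => //.
exact: subset_itv_oc_cc.
Qed.

(** Stated without division, so that s = t is covered: both sides are then 0. The same holds for the
    second area and for the concatenation formulas. *)
Lemma space_time_areaE s t : s <= t ->
  (t - s) * space_time_area W s t w =
  I0 s t - (t - s) * W s w - (t - s) / 2 * (W t w - W s w).
Proof.
rewrite le_eqVlt => /predU1P[<-|st].
  by rewrite (I_refl s).1 subrr !mul0r !subr0.
have h0 : t - s != 0 by rewrite subr_eq0 gt_eqF.
set A := W t w - W s w.
rewrite /space_time_area mulrA divff// mul1r.
transitivity (\int[mu]_(q in `[s, t]) (1 * W q w + 0 * (q * W q w) +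
    ((- W s w + s / (t - s) * A) + (- (A / (t - s))) * q + 0 * q ^+ 2))).
  by apply: eq_Rintegral => q _; rewrite /bridge -/A; field.
by rewrite Rintegral_path ?ltW//; field.
Qed.

Lemma space_time_time_areaE s t : s <= t ->
  (t - s) ^+ 2 * space_time_time_area W s t w =
  (t + s) / 2 * I0 s t - I1 s t + (t - s) ^+ 2 / 12 * (W t w - W s w).
Proof.
rewrite le_eqVlt => /predU1P[<-|st].
  have [-> ->] := I_refl s.
  by rewrite subrr expr0n /= !mul0r mulr0 subr0 addr0.
have h0 : t - s != 0 by rewrite subr_eq0 gt_eqF.
set A := W t w - W s w; set m := (t + s) / 2.
rewrite /space_time_time_area mulrA divff ?expf_neq0// mul1r.
transitivity (\int[mu]_(q in `[s, t]) (m * W q w + (-1) * (q * W q w) +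
    (((- W s w + s / (t - s) * A) * m) +
     (- (A / (t - s)) * m - (- W s w + s / (t - s) * A)) * q +
     (A / (t - s)) * q ^+ 2))).
  by apply: eq_Rintegral => q _; rewrite /bridge -/A -/m; field.
by rewrite Rintegral_path ?ltW// /m; field.
Qed.

Lemma space_time_area_cat s r u : s <= r -> r <= u ->
  (u - s) * space_time_area W s u w =
  (r - s) * space_time_area W s r w + (u - r) * space_time_area W r u w +
  (u - r) / 2 * (W r w - W s w) - (r - s) / 2 * (W u w - W r w).
Proof.
move=> sr ru; rewrite !space_time_areaE ?(le_trans sr)//.
by rewrite /I0 (Rintegral_cat _ s r u)//; field.
Qed.

(** A Chen relation: only the integrals of W and of q W are additive over intervals. The areas on
    the two pieces and the increments enter because each piece has its own midpoint and bridge. *)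
Lemma space_time_time_area_cat s r u : s <= r -> r <= u ->
  (u - s) ^+ 2 * space_time_time_area W s u w =
  (r - s) ^+ 2 * space_time_time_area W s r w +
  (u - r) ^+ 2 * space_time_time_area W r u w +
  (r - s) * (u - r) / 2 * (space_time_area W s r w - space_time_area W r u w) +
  (u - r) * (u - r - (r - s)) / 12 * (W r w - W s w) -
  (r - s) * (u - r - (r - s)) / 12 * (W u w - W r w).
Proof.
move=> sr ru.
have E : (r - s) * (u - r) / 2 *
    (space_time_area W s r w - space_time_area W r u w) =
  (u - r) / 2 * ((r - s) * space_time_area W s r w) -
  (r - s) / 2 * ((u - r) * space_time_area W r u w) by field.
rewrite E !space_time_time_areaE ?(le_trans sr)// !space_time_areaE//.
by rewrite /I0 /I1 !(Rintegral_cat _ s r u)//; field.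
Qed.

(* The triple (W, H, K) of [s, t] consists of the Wiener integrals of 1, 1/2 - x
   and (x^2 - x) / 2 + 1/12 with x = (q - s) / (t - s), which are orthogonal. *)
Definition wiener_kernel (a0 a1 a2 x : R) : R :=
  a0 + a1 * (1 / 2 - x) + a2 * ((x ^+ 2 - x) / 2 + 1 / 12).

(** Summation by parts, here and for squares below: it trades increments of the path for its values,
    hence stochastic sums for Riemann sums. *)
Let abel1 (D : nat -> R) m : \sum_(k < m) k%:R * (D k.+1 - D k) =
  m%:R * D m - \sum_(k < m) D k.+1.
Proof.
elim: m => [|m IH]; first by rewrite !big_ord0 mul0r subr0.
by rewrite !big_ord_recr /= IH -natr1; ring.
Qed.

Let abel2 (D : nat -> R) m : \sum_(k < m) k%:R ^+ 2 * (D k.+1 - D k) =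
  m%:R ^+ 2 * D m - \sum_(k < m) (2 * k.+1%:R - 1) * D k.+1.
Proof.
elim: m => [|m IH]; first by rewrite !big_ord0 expr0n mul0r subr0.
by rewrite !big_ord_recr /= IH -natr1; ring.
Qed.

Definition grid (s t : R) (n k : nat) : R := s + (t - s) * (k%:R / n.+1%:R).

Definition wiener_sum (a0 a1 a2 s t : R) (n : nat) : R :=
  \sum_(k < n.+1) wiener_kernel a0 a1 a2 (k%:R / n.+1%:R) *
    (W (grid s t n k.+1) w - W (grid s t n k) w).

(** The convergence holds path by path: the kernel is polynomial, so summation by parts leaves only
    Riemann sums of the continuous functions W and q W. *)
Lemma cvg_wiener_sum (a0 a1 a2 s t : R) : s <= t ->
  wiener_sum a0 a1 a2 s t n @[n --> \oo] -->
  a0 * (W t w - W s w) + a1 * space_time_area W s t w +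
  a2 * space_time_time_area W s t w.
Proof.
rewrite le_eqVlt => /predU1P[<-|st].
  rewrite /space_time_area /space_time_time_area !subrr expr0n /= invr0 !mul0r.
  rewrite !mulr0 !addr0 (_ : (fun n => _) = cst 0); first exact: cvg_cst.
  apply/funext => n; rewrite /wiener_sum big1// => k _.
  by rewrite /grid subrr !mul0r subrr mulr0.
have h0 : t - s != 0 by rewrite subr_eq0 gt_eqF.
(* The kernel in powers of x: A + B x + C x^2. *)
pose A := a0 + a1 / 2 + a2 / 12; pose B := - a1 - a2 / 2; pose C := a2 / 2.
pose R0 n := (t - s) / n.+1%:R * \sum_(k < n.+1) W (grid s t n k.+1) w.
pose R1 n := (t - s) / n.+1%:R *
  \sum_(k < n.+1) (grid s t n k.+1 * W (grid s t n k.+1) w).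
have cR0 : R0 n @[n --> \oo] --> I0 s t.
  exact: (cvg_riemann_sum _ _ _ (ltW st) cW).
have cR1 : R1 n @[n --> \oo] --> I1 s t.
  exact: (cvg_riemann_sum _ _ _ (ltW st) cqW).
(* The last summand, of order 1 / (n + 1), comes from the -1 in (k + 1)^2 - k^2 = 2 (k + 1) - 1 and
   vanishes in the limit. *)
have sumE n : wiener_sum a0 a1 a2 s t n =
    A * (W t w - W s w) + B * (W t w - (t - s)^-1 * R0 n) +
    C * (W t w - 2 / (t - s) ^+ 2 * (R1 n - s * R0 n) +
      (t - s)^-1 * R0 n * n.+1%:R^-1).
  have N0 : n.+1%:R != 0 :> R by rewrite pnatr_eq0.
  pose D k := W (grid s t n k) w.
  have D0 : D 0%N = W s w by rewrite /D /grid mul0r mulr0 addr0.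
  have DN : D n.+1 = W t w by rewrite /D /grid divff// mulr1 addrC subrK.
  have sR1 : (t - s) / n.+1%:R * \sum_(k < n.+1) (k.+1%:R * D k.+1) =
      n.+1%:R / (t - s) * (R1 n - s * R0 n).
    rewrite /R1 /R0 -/(D _) mulrCA -mulrBr [in RHS]mulr_sumr -sumrB.
    rewrite mulrA !mulr_sumr; apply: eq_bigr => k _.
    rewrite -/(D k.+1) /grid; move: (n.+1%:R) N0 => N N0; field.
    by rewrite h0 N0.
  transitivity (A * \sum_(k < n.+1) (D k.+1 - D k) +
     B / n.+1%:R * \sum_(k < n.+1) k%:R * (D k.+1 - D k) +
     C / n.+1%:R ^+ 2 * \sum_(k < n.+1) k%:R ^+ 2 * (D k.+1 - D k)).
    rewrite !mulr_sumr -!big_split; apply: eq_bigr => k _ /=.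
    rewrite /wiener_kernel -!/(D _) /A /B /C.
    by move: (n.+1%:R) N0 => N N0; field.
  rewrite abel1 abel2.
  have -> : \sum_(k < n.+1) (D k.+1 - D k) = D n.+1 - D 0%N.
    rewrite -(big_mkord xpredT (fun k => D k.+1 - D k)).
    by rewrite telescope_sumr.
  have -> : \sum_(k < n.+1) (2 * k.+1%:R - 1) * D k.+1 =
      2 * \sum_(k < n.+1) (k.+1%:R * D k.+1) - \sum_(k < n.+1) D k.+1.
    rewrite mulr_sumr -sumrB; apply: eq_bigr => k _; ring.
  have -> : \sum_(k < n.+1) (k.+1%:R * D k.+1) =
      n.+1%:R ^+ 2 / (t - s) ^+ 2 * (R1 n - s * R0 n).
    have -> : n.+1%:R ^+ 2 / (t - s) ^+ 2 * (R1 n - s * R0 n) =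
      n.+1%:R / (t - s) * (n.+1%:R / (t - s) * (R1 n - s * R0 n)) by field.
    by rewrite -sR1; move: (n.+1%:R) N0 => N N0; field; rewrite h0 N0.
  have -> : \sum_(k < n.+1) D k.+1 = n.+1%:R / (t - s) * R0 n.
    by rewrite /R0; move: (n.+1%:R) N0 => N N0; field; rewrite h0 N0.
  rewrite D0 DN; move: (n.+1%:R) N0 (R0 n) (R1 n) => N N0 r0 r1.
  by field; rewrite h0 N0.
rewrite (_ : (fun n => _) = (fun n =>
    A * (W t w - W s w) + B * (W t w - (t - s)^-1 * R0 n) +
    C * (W t w - 2 / (t - s) ^+ 2 * (R1 n - s * R0 n) +
      (t - s)^-1 * R0 n * n.+1%:R^-1))); last exact/funext.
have -> : a0 * (W t w - W s w) + a1 * space_time_area W s t w +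
    a2 * space_time_time_area W s t w =
  A * (W t w - W s w) + B * (W t w - (t - s)^-1 * I0 s t) +
    C * (W t w - 2 / (t - s) ^+ 2 * (I1 s t - s * I0 s t) +
      (t - s)^-1 * I0 s t * 0).
  have -> : space_time_area W s t w = (t - s)^-1 *
      (I0 s t - (t - s) * W s w - (t - s) / 2 * (W t w - W s w)).
    by rewrite -space_time_areaE ?ltW// mulrA mulVf// mul1r.
  have -> : space_time_time_area W s t w = (t - s) ^- 2 *
      ((t + s) / 2 * I0 s t - I1 s t + (t - s) ^+ 2 / 12 * (W t w - W s w)).
    by rewrite -space_time_time_areaE ?ltW// mulrA mulVf ?expf_neq0// mul1r.
  by rewrite /A /B /C; field.
have cZ (c l : R) (g : nat -> R) : g n @[n --> \oo] --> l ->
    c * g n @[n --> \oo] --> c * l.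
  by move=> gl; apply: cvgM => //; exact: cvg_cst.
have cB (c l : R) (g : nat -> R) : g n @[n --> \oo] --> l ->
    c - g n @[n --> \oo] --> c - l.
  by move=> gl; apply: cvgB => //; exact: cvg_cst.
apply: cvgD.
  apply: cvgD; first exact: cvg_cst.
  by apply: (cZ _ _ _); apply: (cB _ _ _); exact: (cZ _ _ _).
apply: (cZ _ _ _); apply: cvgD.
  by apply: (cB _ _ _); apply: (cZ _ _ _); apply: cvgB => //; exact: (cZ _ _ _).
by apply: cvgM; [exact: (cZ _ _ _)|exact: cvg_harmonic].
Qed.

End PathAreas.

Section WienerVariance.
Context {R : realType}.

Let power_sums (m : nat) : let N : R := m%:R in
  [/\ \sum_(k < m) k%:R = N * (N - 1) / 2 :> R,
      \sum_(k < m) k%:R ^+ 2 = N * (N - 1) * (2 * N - 1) / 6 :> R,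
      \sum_(k < m) k%:R ^+ 3 = N ^+ 2 * (N - 1) ^+ 2 / 4 :> R &
      \sum_(k < m) k%:R ^+ 4 =
        N * (N - 1) * (2 * N - 1) * (3 * N ^+ 2 - 3 * N - 1) / 30 :> R].
Proof.
elim: m => [|m [IH1 IH2 IH3 IH4]].
  by rewrite !big_ord0 /= !(mul0r, expr0n).
by rewrite /= !big_ord_recr /= IH1 IH2 IH3 IH4 -natr1; split; field.
Qed.

(** The limit is h times the integral over [0, 1] of the squared kernel, and 1, 1 / 12, 1 / 720 are
    the squared norms of its orthogonal components. The sums of powers make it exact for every n. *)
Lemma cvg_wiener_variance (a0 a1 a2 h : R) :
  \sum_(k < n.+1) wiener_kernel a0 a1 a2 (k%:R / n.+1%:R) ^+ 2 *
    (h / n.+1%:R) @[n --> \oo] -->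
  h * (a0 ^+ 2 + a1 ^+ 2 / 12 + a2 ^+ 2 / 720).
Proof.
pose A := a0 + a1 / 2 + a2 / 12; pose B := - a1 - a2 / 2; pose C := a2 / 2.
(* The exact sum is a polynomial in e = 1 / (n + 1); the limit is its value at 0. *)
pose q (e : R) : R := h * (A ^+ 2 + A * B * (1 - e) +
  (B ^+ 2 + 2 * A * C) * ((1 - e) * (2 - e) / 6) +
  2 * B * C * ((1 - e) * (1 - e) / 4) +
  C ^+ 2 * ((1 - e) * (2 - e) * (3 - 3 * e - e * e) / 30)).
rewrite (_ : (fun n => _) = fun n : nat => q (n.+1%:R^-1)); last first.
  apply/funext => n.
  have [S1 S2 S3 S4] := power_sums n.+1.
  have N0 : n.+1%:R != 0 :> R by rewrite pnatr_eq0.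
  transitivity (h / n.+1%:R * (\sum_(k < n.+1) A ^+ 2 +
    2 * A * B / n.+1%:R * \sum_(k < n.+1) k%:R +
    (B ^+ 2 + 2 * A * C) / n.+1%:R ^+ 2 * \sum_(k < n.+1) k%:R ^+ 2 +
    2 * B * C / n.+1%:R ^+ 3 * \sum_(k < n.+1) k%:R ^+ 3 +
    C ^+ 2 / n.+1%:R ^+ 4 * \sum_(k < n.+1) k%:R ^+ 4)).
    rewrite !mulr_sumr -!big_split /= mulr_sumr; apply: eq_bigr => k _ /=.
    rewrite /wiener_kernel /A /B /C.
    by move: (n.+1%:R) N0 => N N0; field.
  rewrite S1 S2 S3 S4 sumr_const card_ord -(mulr_natr (A ^+ 2)) /q.
  by move: (n.+1%:R) N0 => N N0; field.
have -> : h * (a0 ^+ 2 + a1 ^+ 2 / 12 + a2 ^+ 2 / 720) = q 0.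
  by rewrite /q /A /B /C; field.
have ce : n.+1%:R^-1 @[n --> \oo] --> (0 : R) by exact: cvg_harmonic.
have cZ (c l : R) (g : nat -> R) : g n @[n --> \oo] --> l ->
    c * g n @[n --> \oo] --> c * l.
  by move=> gl; apply: cvgM => //; exact: cvg_cst.
have cB (c : R) : c - n.+1%:R^-1 @[n --> \oo] --> c - 0.
  by apply: cvgB => //; exact: cvg_cst.
have c12 : (1 - n.+1%:R^-1) * (2 - n.+1%:R^-1) @[n --> \oo] -->
  ((1 - 0) * (2 - 0) : R) by exact: cvgM.
apply: (cZ _ _ _); apply: cvgD; last first.
  apply: (cZ _ _ _); apply: cvgM; last exact: cvg_cst.
  apply: cvgM => //; apply: cvgB; last exact: cvgM.
  by apply: cvgB; [exact: cvg_cst|exact: (cZ _ _ _)].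
apply: cvgD; last first.
  by apply: (cZ _ _ _); apply: cvgM; [exact: cvgM|exact: cvg_cst].
apply: cvgD; last by apply: (cZ _ _ _); apply: cvgM => //; exact: cvg_cst.
by apply: cvgD; [exact: cvg_cst|exact: (cZ _ _ _)].
Qed.

End WienerVariance.

(** * Joint cosine transform of the areas on adjacent intervals *)

Section LevyTransform.
Context {R : realType} {d : measure_display} {T : measurableType d}.
Variables (P : probability T R) (W : R -> T -> R).
Hypothesis hW : standard_brownian P W.

Definition levy_comb (a0 a1 a2 s t : R) (w : T) : R :=
  a0 * (W t w - W s w) + a1 * space_time_area W s t w +
  a2 * space_time_time_area W s t w.

Let X := extend_path W.

Let cX w : continuous (fun q : R => X q w).
Proof. exact/extend_path_continuous/(bm_continuous hW). Qed.

Let measurable_X q : measurable_fun [set: T] (X q).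
Proof. by apply: (bm_measurable hW); rewrite le_max lexx. Qed.

Let measurable_wiener_sum a0 a1 a2 s t n :
  measurable_fun [set: T] (fun w => wiener_sum X w a0 a1 a2 s t n).
Proof.
apply: measurable_sum => i; apply: measurable_funM => //.
by apply: measurable_funB; exact: measurable_X.
Qed.

Let cvg_levy_comb a0 a1 a2 s t w : 0 <= s -> s <= t ->
  wiener_sum X w a0 a1 a2 s t n @[n --> \oo] --> levy_comb a0 a1 a2 s t w.
Proof.
move=> s0 st; have e := levy_triple_extend W s t w s0 st.
have e0 : X t w - X s w = W t w - W s w.
  exact: (congr1 (fun v : 3.-tuple R => v`_0) e).
have e1 : space_time_area X s t w = space_time_area W s t w.
  exact: (congr1 (fun v : 3.-tuple R => v`_1) e).
have e2 : space_time_time_area X s t w = space_time_time_area W s t w.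
  exact: (congr1 (fun v : 3.-tuple R => v`_2) e).
rewrite /levy_comb -e0 -e1 -e2.
exact: (cvg_wiener_sum X w (cX w)).
Qed.

(** The areas are time integrals with a parameter [w]; measurability in [w] comes from the pointwise
    limit of finite combinations of increments. *)
Lemma measurable_levy_comb a0 a1 a2 s t : 0 <= s -> s <= t ->
  measurable_fun [set: T] (levy_comb a0 a1 a2 s t).
Proof.
move=> s0 st.
apply: (measurable_fun_cvg (measurable_wiener_sum a0 a1 a2 s t)) => w _.
exact: cvg_levy_comb.
Qed.

Lemma measurable_levy_triple s t : 0 <= s -> s <= t ->
  measurable_fun [set: T] (levy_triple W s t).
Proof.
move=> s0 st; apply/measurable_fun_tnthP => -[[|[|[|//]]] i3].
- rewrite (_ : _ \o _ = levy_comb 1 0 0 s t); first exact: measurable_levy_comb.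
  by apply/funext => w; rewrite /levy_comb /= (tnth_nth 0) /=; ring.
- rewrite (_ : _ \o _ = levy_comb 0 1 0 s t); first exact: measurable_levy_comb.
  by apply/funext => w; rewrite /levy_comb /= (tnth_nth 0) /=; ring.
- rewrite (_ : _ \o _ = levy_comb 0 0 1 s t); first exact: measurable_levy_comb.
  by apply/funext => w; rewrite /levy_comb /= (tnth_nth 0) /=; ring.
Qed.

Definition levy_variance (a0 a1 a2 : R) : R :=
  a0 ^+ 2 + a1 ^+ 2 / 12 + a2 ^+ 2 / 720.

Section TwoIntervals.
Variables (s r u : R).
Hypotheses (s0 : 0 <= s) (sr : s <= r) (ru : r <= u).

(** The grids of [s, r] and [r, u] glued at index n + 1, where both equal r. As a single
    nondecreasing sequence, it makes the independence of the two intervals part of the independence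
    of increments. *)
Let time (n i : nat) : R :=
  if (i <= n.+1)%N then grid s r n i else grid r u n (i - n.+1).

Let timeE n j : time n (n.+1 + j)%N = grid r u n j.
Proof.
rewrite /time; case: j => [|j].
  rewrite addn0 leqnn /grid divff ?pnatr_eq0// mulr1 mul0r mulr0 addr0.
  by rewrite addrC subrK.
by rewrite -[X in (_ <= X)%N]addn0 leq_add2l ltn0 addKn.
Qed.

Let gridS (a b : R) n k : grid a b n k.+1 - grid a b n k = (b - a) / n.+1%:R.
Proof. by rewrite /grid -natr1; ring. Qed.

Let time_nd n : nondecreasing_seq (time n).
Proof.
apply/nondecreasing_seqP => i.
have gridle (a b : R) k : a <= b -> grid a b n k <= grid a b n k.+1.
  by move=> ab; rewrite -subr_ge0 gridS divr_ge0// subr_ge0.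
case: (ltnP i n.+1) => hi.
  by rewrite /time hi (ltnW hi) gridle.
by rewrite -(subnKC hi) -addnS !timeE gridle.
Qed.

Let time_ge0 n i : 0 <= time n i.
Proof.
apply: le_trans (time_nd n 0%N i (leq0n i)).
by rewrite /time /= /grid mul0r mulr0 addr0.
Qed.

Let cos_wiener_sums (a0 a1 a2 b0 b1 b2 p : R) n :
  \int[P]_w cos (wiener_sum X w a0 a1 a2 s r n +
                 wiener_sum X w b0 b1 b2 r u n + p) =
  cos p * expR (- ((
    \sum_(k < n.+1) wiener_kernel a0 a1 a2 (k%:R / n.+1%:R) ^+ 2 *
      ((r - s) / n.+1%:R) +
    \sum_(k < n.+1) wiener_kernel b0 b1 b2 (k%:R / n.+1%:R) ^+ 2 *
      ((u - r) / n.+1%:R)) / 2)).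
Proof.
pose c (i : nat) : R := if (i < n.+1)%N
  then wiener_kernel a0 a1 a2 (i%:R / n.+1%:R)
  else wiener_kernel b0 b1 b2 ((i - n.+1)%:R / n.+1%:R).
have c1 (i : 'I_n.+1) : c i = wiener_kernel a0 a1 a2 (i%:R / n.+1%:R).
  by rewrite /c ltn_ord.
have c2 (i : 'I_n.+1) : c (n.+1 + i)%N = wiener_kernel b0 b1 b2 (i%:R / n.+1%:R).
  by rewrite /c ltnNge leq_addr /= addKn.
have t1 (i : 'I_n.+1) : time n i = grid s r n i by rewrite /time ltnW.
have t1S (i : 'I_n.+1) : time n i.+1 = grid s r n i.+1 by rewrite /time ltn_ord.
have := cos_increments P W hW (n.+1 + n.+1) c (time n) p (time_ge0 n 0)
  (time_nd n).
rewrite [in X in _ = X -> _]big_split_ord /=.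
under [X in _ = _ * expR (- ((X + _) / 2)) -> _]eq_bigr do
  rewrite c1 t1 t1S gridS.
under [X in _ = _ * expR (- ((_ + X) / 2)) -> _]eq_bigr do
  rewrite c2 -addnS !timeE gridS.
move=> <-; apply: eq_Rintegral => w _; congr (cos (_ + _)).
rewrite big_split_ord /=; congr (_ + _); apply: eq_bigr => i _.
  by rewrite c1 t1 t1S /X !extend_pathE// -?t1S -?t1.
by rewrite c2 -addnS !timeE /X !extend_pathE// -timeE.
Qed.

Lemma cos_levy_comb (a0 a1 a2 b0 b1 b2 p : R) :
  \int[P]_w cos (levy_comb a0 a1 a2 s r w + levy_comb b0 b1 b2 r u w + p) =
  cos p * expR (- (((r - s) * levy_variance a0 a1 a2 +
                    (u - r) * levy_variance b0 b1 b2) / 2)).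
Proof.
have r0 := le_trans s0 sr.
have [|||||_ c1] := @cvg_Rintegral _ _ _ P [set: T]
  (fun n w => cos (wiener_sum X w a0 a1 a2 s r n +
                   wiener_sum X w b0 b1 b2 r u n + p))
  (fun w => cos (levy_comb a0 a1 a2 s r w + levy_comb b0 b1 b2 r u w + p))
  (cst 1).
- by [].
- move=> n; apply: (bounded_measurable_cos _ _).1.
  by apply: measurable_funD => //; exact: measurable_funD.
- exact/bounded_measurable_integrable/bounded_measurable_cst.
- move=> w _; apply: continuous_cvg; first exact: continuous_cos.
  apply: cvgD; last exact: cvg_cst.
  by apply: cvgD; exact: cvg_levy_comb.
- by move=> n w _ /=; rewrite ler_norml cos_geN1 cos_le1.
apply: (cvg_unique _ c1) => //.
rewrite (_ : (fun n => _) = (fun n => cos p * expR (- ((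
    \sum_(k < n.+1) wiener_kernel a0 a1 a2 (k%:R / n.+1%:R) ^+ 2 *
      ((r - s) / n.+1%:R) +
    \sum_(k < n.+1) wiener_kernel b0 b1 b2 (k%:R / n.+1%:R) ^+ 2 *
      ((u - r) / n.+1%:R)) / 2)))); last exact/funext/cos_wiener_sums.
apply: cvgM; first exact: cvg_cst.
apply: continuous_cvg; first exact: continuous_expR.
apply: cvgN; apply: cvgM; last exact: cvg_cst.
by apply: cvgD; exact: cvg_wiener_variance.
Qed.

End TwoIntervals.
End LevyTransform.

(** * Conditioning on an independent translation *)

Section TranslatedLaw.
Context {R : realType} {d : measure_display} {T : measurableType d} {n : nat}.
Variables (P : probability T R) (Z : T -> n.-tuple R).
Variable m : n.-tuple R -> n.-tuple R.
Hypotheses (mZ : measurable_fun [set: T] Z)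
  (mm : measurable_fun [set: n.-tuple R] m).

Definition tuple_add (x y : n.-tuple R) : n.-tuple R :=
  [tuple tnth x i + tnth y i | i < n].

Lemma measurable_tuple_add d' (T' : measurableType d') (f g : T' -> n.-tuple R) :
  measurable_fun [set: T'] f -> measurable_fun [set: T'] g ->
  measurable_fun [set: T'] (fun x => tuple_add (f x) (g x)).
Proof.
move=> mf mg; apply/measurable_fun_tnthP => i.
rewrite (_ : _ \o _ = (@tnth _ R ^~ i \o f) \+ (@tnth _ R ^~ i \o g)).
  by apply: measurable_funD; [move/measurable_fun_tnthP : mf|
    move/measurable_fun_tnthP : mg]; exact.
by apply/funext => x /=; rewrite tnth_mktuple.
Qed.

Lemma measurable_translate y : measurable_fun [set: T] (fun w => tuple_add (m y) (Z w)).
Proof. by apply: measurable_tuple_add => //; exact: measurable_cst. Qed.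

Definition translated_law (y : n.-tuple R) :
  {measure set (n.-tuple R) -> \bar R} := law P _ (measurable_translate y).

Let graph (U : set (n.-tuple R)) : set (n.-tuple R * T) :=
  (fun z => tuple_add (m z.1) (Z z.2)) @^-1` U.

Let measurable_graph U : measurable U -> measurable (graph U).
Proof.
move=> mU; rewrite -[X in measurable X]setTI.
by apply: measurable_tuple_add => //; exact: measurableT_comp.
Qed.

Let measurable_translated_law U : measurable U ->
  measurable_fun [set: n.-tuple R] (translated_law ^~ U).
Proof.
move=> mU; apply: (eq_measurable_fun (P \o xsection (graph U))).
  move=> y _; congr (P _); apply/seteqP.
  by split => w; rewrite /xsection /= inE.
apply: measurable_fun_xsection.
exact: measurable_graph.
Qed.

HB.instance Definition _ := isKernel.Build _ _ _ _ R translated_law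
  measurable_translated_law.

Let translated_law_setT y : translated_law y [set: _] = 1%E.
Proof. exact: probability_setT. Qed.

HB.instance Definition _ := Kernel_isProbability.Build _ _ _ _ R translated_law
  translated_law_setT.

Definition translated_kernel : R.-pker (n.-tuple R) ~> (n.-tuple R) :=
  translated_law.

Variable Y : T -> n.-tuple R.
Hypothesis mY : measurable_fun [set: T] Y.
Hypothesis ZY : forall A B, measurable A -> measurable B ->
  P (Z @^-1` A `&` Y @^-1` B) = (P (Z @^-1` A) * P (Y @^-1` B))%E.

(** By independence the pair (Y, Z) has the product law. The event becomes a set [D] of pairs, and
    integrating its sections over the first coordinate is the disintegration. *)
Lemma translated_kernel_cond_distribution (V : T -> n.-tuple R) :
  measurable_fun [set: T] V ->
  (forall w, V w = tuple_add (m (Y w)) (Z w)) ->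
  cond_distribution P V Y translated_kernel.
Proof.
move=> mV VE; split => // A B mA mB.
pose D : set (n.-tuple R * n.-tuple R) :=
  [set z | B z.1 /\ A (tuple_add (m z.1) z.2)].
have mD : measurable D.
  rewrite (_ : D = ([set: _] `&` fst @^-1` B) `&`
    ([set: _] `&` (fun z => tuple_add (m z.1) z.2) @^-1` A)); last first.
    by apply/seteqP; split => z; [move=> [? ?]|move=> [[_ ?] [_ ?]]].
  apply: measurableI; first exact: measurable_fst.
  by apply: measurable_tuple_add => //; exact: measurableT_comp.
have YZ A' B' : measurable A' -> measurable B' ->
    P (Y @^-1` A' `&` Z @^-1` B') = (P (Y @^-1` A') * P (Z @^-1` B'))%E.
  by move=> mA' mB'; rewrite setIC muleC ZY.
transitivity (law P _ (measurable_fun_pair mY mZ) D).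
  rewrite lawE; congr (P _); apply/seteqP.
  by split => w /=; rewrite /D /= VE => -[].
rewrite (law_pair P Y Z mY mZ YZ D mD) /product_measure1.
rewrite [RHS]integral_mkcond /law /distribution ge0_integral_pushforward//; last first.
  exact: measurable_fun_xsection.
apply: eq_integral => w _; rewrite patchE; case: ifPn => [|].
  rewrite inE /= => BYw; congr (P _); apply/seteqP.
  split => w'; rewrite /xsection /= inE /D /=; first by case.
  by [].
rewrite notin_setE /= => BYw.
rewrite /= (_ : xsection D (Y w) = set0) ?measure0//.
by apply/seteqP; split => z //; rewrite /xsection /= inE /D /= => -[].
Qed.

(** An event of the sigma-algebra of [Y] is a preimage under [Y], so independence pulls out the
    constant expectation of [f (Z w)]. It serves with c = 0 for the mean and with an entry of Sigma
    for the covariance. *)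
Lemma independent_integral_preimage (f : n.-tuple R -> R) (c : R) (A : set T) :
  measurable_fun [set: n.-tuple R] f ->
  P.-integrable [set: T] (EFin \o (f \o Z)) -> \int[P]_w f (Z w) = c ->
  g_sigma_algebra_preimage Y A ->
  (\int[P]_(w in A) (f (Z w))%:E = \int[P]_(w in A) c%:E)%E.
Proof.
move=> mf fi fc [B mB <-].
rewrite setTI; have mYB : measurable (Y @^-1` B).
  by rewrite -[X in measurable X]setTI; exact: mY.
have b1 : bounded_measurable (\1_B : n.-tuple R -> R).
  split; first exact: measurable_indic.
  by exists 1 => x; rewrite indicE ger0_norm ?ler0n// lern1 leq_b1.
have := independent_Rintegral P Z Y mZ mY ZY f \1_B mf fi b1.
rewrite fc => h.
have iB : P.-integrable (Y @^-1` B) (EFin \o (f \o Z)).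
  exact: integrableS fi.
have memYB w : (Y w \in B) = (w \in Y @^-1` B).
  by apply/idP/idP; rewrite !inE.
have P1 : \int[P]_w (\1_B (Y w) : R) = fine (P (Y @^-1` B)).
  transitivity (\int[P]_w (\1_(Y @^-1` B) w : R)).
    by apply: eq_Rintegral => w _; rewrite !indicE memYB.
  by rewrite /Rintegral integral_indic// setIT.
rewrite integral_cst// -[RHS](fineK _); last first.
  by rewrite fin_numM// fin_num_measure.
rewrite -[LHS](fineK (integrable_fin_num _ iB))//; congr EFin.
rewrite fineM ?fin_num_measure// -P1 -h; congr fine.
rewrite integral_mkcond; apply: eq_integral => w _.
rewrite patchE indicE memYB.
by case: (w \in _); rewrite ?mulr1 ?mulr0.
Qed.

End TranslatedLaw.

(** * The covariance form *)

Section ThreeCoordinates.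
Context {R : realType}.

Let o0 : 'I_3 := @Ordinal 3 0 isT.
Let o1 : 'I_3 := @Ordinal 3 1 isT.
Let o2 : 'I_3 := @Ordinal 3 2 isT.

Lemma sum_ord3 (F : 'I_3 -> R) : \sum_(i < 3) F i = F o0 + F o1 + F o2.
Proof.
rewrite !big_ord_recr big_ord0 /= add0r.
by congr (F _ + F _ + F _); apply/val_inj.
Qed.

Lemma ord3_cases (Q : 'I_3 -> Prop) : Q o0 -> Q o1 -> Q o2 -> forall i, Q i.
Proof.
move=> Q0 Q1 Q2 [[|[|[|//]]] i3].
- by rewrite (_ : Ordinal _ = o0)//; exact/val_inj.
- by rewrite (_ : Ordinal _ = o1)//; exact/val_inj.
- by rewrite (_ : Ordinal _ = o2)//; exact/val_inj.
Qed.

Definition mx_form (S : 'M[R]_3) (x : 'I_3 -> R) : R :=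
  \sum_(i < 3) \sum_(j < 3) x i * x j * S i j.

Lemma levy_variance_ge0 (a0 a1 a2 : R) : 0 <= levy_variance a0 a1 a2.
Proof.
apply: addr_ge0; first apply: addr_ge0; first exact: sqr_ge0.
  by apply: divr_ge0; [exact: sqr_ge0|exact: ler0n].
by apply: divr_ge0; [exact: sqr_ge0|exact: ler0n].
Qed.

Variables s r u : R.

Lemma Sigma_sym (i j : 'I_3) : Sigma s r u i j = Sigma s r u j i.
Proof.
by move: i j; apply: ord3_cases; apply: ord3_cases; rewrite !mxE.
Qed.

Lemma mx_form_Sigma x : mx_form (Sigma s r u) x =
  x o0 ^+ 2 * SigmaWW s r u + x o1 ^+ 2 * SigmaHH s r u +
  x o2 ^+ 2 * SigmaKK s r u + 2 * x o0 * x o1 * SigmaWH s r u +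
  2 * x o0 * x o2 * SigmaWK s r u + 2 * x o1 * x o2 * SigmaHK s r u.
Proof.
rewrite /mx_form !sum_ord3.
have -> : Sigma s r u o0 o0 = SigmaWW s r u by rewrite mxE.
have -> : Sigma s r u o0 o1 = SigmaWH s r u by rewrite mxE.
have -> : Sigma s r u o0 o2 = SigmaWK s r u by rewrite mxE.
have -> : Sigma s r u o1 o0 = SigmaWH s r u by rewrite mxE.
have -> : Sigma s r u o1 o1 = SigmaHH s r u by rewrite mxE.
have -> : Sigma s r u o1 o2 = SigmaHK s r u by rewrite mxE.
have -> : Sigma s r u o2 o0 = SigmaWK s r u by rewrite mxE.
have -> : Sigma s r u o2 o1 = SigmaHK s r u by rewrite mxE.
have -> : Sigma s r u o2 o2 = SigmaKK s r u by rewrite mxE.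
ring.
Qed.

Lemma mx_formZ (S : 'M[R]_3) (t : R) x : mx_form S (fun i => t * x i) = t ^+ 2 * mx_form S x.
Proof. by rewrite /mx_form !sum_ord3; ring. Qed.

(** The transform gives only second moments of linear combinations; polarization with e_i + e_j and
    e_i - e_j recovers each entry. *)
Lemma mx_form_polarization (S : 'M[R]_3) (i j : 'I_3) : (forall i j, S i j = S j i) ->
  mx_form S (fun k => (k == i)%:R + (k == j)%:R) -
  mx_form S (fun k => (k == i)%:R - (k == j)%:R) = 4 * S i j.
Proof.
move=> S_sym; rewrite /mx_form !sum_ord3.
rewrite (S_sym o1 o0) (S_sym o2 o0) (S_sym o2 o1).
move: i j; apply: ord3_cases; apply: ord3_cases;
  by rewrite /= ?(S_sym o1 o0) ?(S_sym o2 o0) ?(S_sym o2 o1); ring.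
Qed.

(** The variance of x . Y_{s,u}. *)
Definition increment_form (x : 'I_3 -> R) : R :=
  (u - s) * levy_variance (x o0) (x o1) (x o2).

Section Coefficients.
Variables x y : 'I_3 -> R.
Let a := r - s.
Let b := u - r.
Let h := u - s.

(* With Z the residual of Y_{s,r} given Y_{s,u},
   x . Z + y . Y_{s,u} = left_coef . Y_{s,r} + right_coef . Y_{r,u}: the residual
   coefficients are those of Y_{s,u} in x . (Z - Y_{s,r}) + y . Y_{s,u}, and
   Y_{s,u} is linear in (Y_{s,r}, Y_{r,u}) by the concatenation formulas. *)
Definition residual_coef (i : nat) : R :=
  match i with
  | 0%N => y o0 - x o0 * a / h
  | 1%N => y o1 - 6 * a * b / h ^+ 2 * x o0 - a ^+ 2 / h ^+ 2 * x o1
  | _ => y o2 - 120 * a * b * ((u + s) / 2 - r) / h ^+ 3 * x o0 -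
         30 * a ^+ 2 * b / h ^+ 3 * x o1 - a ^+ 3 / h ^+ 3 * x o2
  end.
Let z := residual_coef.

Definition left_coef (i : nat) : R :=
  match i with
  | 0%N => x o0 + z 0 + z 1 * b / (2 * h) + z 2 * b * (b - a) / (12 * h ^+ 2)
  | 1%N => x o1 + z 1 * a / h + z 2 * a * b / (2 * h ^+ 2)
  | _ => x o2 + z 2 * a ^+ 2 / h ^+ 2
  end.

Definition right_coef (i : nat) : R :=
  match i with
  | 0%N => z 0 - z 1 * a / (2 * h) - z 2 * a * (b - a) / (12 * h ^+ 2)
  | 1%N => z 1 * b / h - z 2 * a * b / (2 * h ^+ 2)
  | _ => z 2 * b ^+ 2 / h ^+ 2
  end.

(* There is no cross term in x and y: Z and Y_{s,u} are uncorrelated. *)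
Lemma levy_variance_split : h != 0 ->
  a * levy_variance (left_coef 0) (left_coef 1) (left_coef 2) +
  b * levy_variance (right_coef 0) (right_coef 1) (right_coef 2) =
  mx_form (Sigma s r u) x + increment_form y.
Proof.
move=> h0; rewrite mx_form_Sigma /increment_form /levy_variance /left_coef /right_coef.
rewrite /z /residual_coef /SigmaWW /SigmaWH /SigmaWK /SigmaHH /SigmaHK /SigmaKK.
have hE : h = a + b by rewrite /h /a /b; ring.
rewrite -/a -/b -/h.
have -> : 2 * r - u - s = a - b by rewrite /a /b; ring.
have -> : (u + s) / 2 - r = (b - a) / 2 by rewrite /a /b; field.
(* With h = a + b the claim is a rational identity in eight free variables whose only denominators
   are powers of a + b and numerals, so a = 0 and b = 0 are covered. *)
move: h0; rewrite hE; move: a b (x o0) (x o1) (x o2) (y o0) (y o1) (y o2).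
move=> a' b' x0 x1 x2 y0 y1 y2 h0.
by field.
Qed.

End Coefficients.
End ThreeCoordinates.

(** * The residual: law, independence and conditional moments *)

Section Conditioning.
Context {R : realType} {d : measure_display} {T : measurableType d}.
Variables (P : probability T R) (W : R -> T -> R).
Hypothesis hW : standard_brownian P W.
Variables s r u : R.
Hypotheses (hs : 0 <= s) (hsu : s < u) (hsr : s <= r) (hru : r <= u).

Let Yr := levy_triple W s r.
Let Yu := levy_triple W s u.

Definition residual (w : T) : 3.-tuple R :=
  [tuple tnth (Yr w) i - tnth (mean_triple s r u (Yu w)) i | i < 3].

Let Z := residual.

Let h0 : u - s != 0. Proof. by rewrite subr_eq0 gt_eqF. Qed.
Let r0 : 0 <= r. Proof. exact: le_trans hs hsr. Qed.

Let area_extendE a b w : 0 <= a -> a <= b ->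
  [/\ extend_path W a w = W a w, extend_path W b w = W b w,
      space_time_area (extend_path W) a b w = space_time_area W a b w &
      space_time_time_area (extend_path W) a b w = space_time_time_area W a b w].
Proof.
move=> a0 ab; have e := levy_triple_extend W a b w a0 ab.
split; first by rewrite extend_pathE.
- by rewrite extend_pathE// (le_trans a0).
- exact: (congr1 (fun v : 3.-tuple R => v`_1) e).
- exact: (congr1 (fun v : 3.-tuple R => v`_2) e).
Qed.

Lemma levy_comb_split (x y : 'I_3 -> R) w :
  \sum_(i < 3) x i * tnth (Z w) i + \sum_(i < 3) y i * tnth (Yu w) i =
  levy_comb W (left_coef s r u x y 0) (left_coef s r u x y 1)
    (left_coef s r u x y 2) s r w +
  levy_comb W (right_coef s r u x y 0) (right_coef s r u x y 1)
    (right_coef s r u x y 2) r u w.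
Proof.
have cX : continuous (fun q : R => extend_path W q w).
  exact/extend_path_continuous/(bm_continuous hW).
have := space_time_area_cat _ w cX s r u hsr hru.
have := space_time_time_area_cat _ w cX s r u hsr hru.
have [-> -> -> ->] := area_extendE s u w hs (ltW hsu).
have [_ -> -> ->] := area_extendE s r w hs hsr.
have [_ _ -> ->] := area_extendE r u w r0 hru.
move=> KE HE.
have {}HE : space_time_area W s u w = ((r - s) * space_time_area W s r w +
   (u - r) * space_time_area W r u w +
   (u - r) / 2 * (W r w - W s w) - (r - s) / 2 * (W u w - W r w)) / (u - s).
  by rewrite -HE mulrC mulKf.
have {}KE : space_time_time_area W s u w =
  ((r - s) ^+ 2 * space_time_time_area W s r w +
   (u - r) ^+ 2 * space_time_time_area W r u w +
   (r - s) * (u - r) / 2 * (space_time_area W s r w - space_time_area W r u w) +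
   (u - r) * (u - r - (r - s)) / 12 * (W r w - W s w) -
   (r - s) * (u - r - (r - s)) / 12 * (W u w - W r w)) / (u - s) ^+ 2.
  by rewrite -KE mulrC mulKf// expf_neq0.
rewrite !sum_ord3 /Z /residual !tnth_mktuple.
have YE (v : 3.-tuple R) : (tnth v (@Ordinal 3 0 isT) = v`_0) *
    (tnth v (@Ordinal 3 1 isT) = v`_1) * (tnth v (@Ordinal 3 2 isT) = v`_2).
  by rewrite !(tnth_nth 0).
rewrite !YE /Yr /Yu /levy_triple /mean_triple /= KE HE /levy_comb.
rewrite /left_coef /right_coef /residual_coef.
move: (space_time_area W s r w) (space_time_area W r u w)
  (space_time_time_area W s r w) (space_time_time_area W r u w)
  (W s w) (W r w) (W u w) => H1 H2 K1 K2 Ws Wr Wu.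
move: (x _) (x _) (x _) (y _) (y _) (y _) => x0 x1 x2 y0 y1 y2.
by field.
Qed.

Let mYr : measurable_fun [set: T] Yr.
Proof. exact: (measurable_levy_triple P). Qed.

Let mYu : measurable_fun [set: T] Yu.
Proof. by apply: (measurable_levy_triple P) => //; exact: ltW. Qed.

Lemma measurable_mean_triple :
  measurable_fun [set: 3.-tuple R] (mean_triple s r u).
Proof.
have mt (i : 'I_3) := @measurable_tnth _ R 3 i.
have mn (k : nat) (k3 : (k < 3)%N) :
    measurable_fun [set: 3.-tuple R] (fun y : 3.-tuple R => y`_k).
  rewrite (_ : (fun y => _) = @tnth 3 R ^~ (Ordinal k3)); first exact: mt.
  by apply/funext => y; rewrite (tnth_nth 0).
apply/measurable_fun_tnthP; apply: ord3_cases.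
- rewrite (_ : _ \o _ = fun y : 3.-tuple R => (r - s) / (u - s) * y`_0
    + 6 * ((r - s) * (u - r) / (u - s) ^+ 2) * y`_1
    + 120 * ((r - s) * (u - r) * ((u + s) / 2 - r) / (u - s) ^+ 3) * y`_2)//.
  apply: measurable_funD; first apply: measurable_funD;
    by apply: measurable_funM => //; exact: mn.
- rewrite (_ : _ \o _ = fun y : 3.-tuple R =>
    (r - s) ^+ 2 / (u - s) ^+ 2 * y`_1
       + 30 * ((r - s) ^+ 2 * (u - r) / (u - s) ^+ 3) * y`_2)//.
  by apply: measurable_funD; apply: measurable_funM => //; exact: mn.
- rewrite (_ : _ \o _ = fun y : 3.-tuple R =>
    (r - s) ^+ 3 / (u - s) ^+ 3 * y`_2)//.
  by apply: measurable_funM => //; exact: mn.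
Qed.

Let mM : measurable_fun [set: T] (fun w => mean_triple s r u (Yu w)).
Proof. exact: measurableT_comp measurable_mean_triple mYu. Qed.

Let mtnth n (V : T -> n.-tuple R) (i : 'I_n) : measurable_fun [set: T] V ->
  measurable_fun [set: T] (fun w => tnth (V w) i).
Proof. by move/measurable_fun_tnthP; exact. Qed.

Let mZ : measurable_fun [set: T] Z.
Proof.
apply/measurable_fun_tnthP => i.
apply: (eq_measurable_fun (fun w =>
  tnth (Yr w) i - tnth (mean_triple s r u (Yu w)) i)).
  by move=> w _; rewrite /= tnth_mktuple.
by apply: measurable_funB; exact: mtnth.
Qed.

Let QZ := mx_form (Sigma s r u).
Let QY := @increment_form R s u.

Lemma cos_residual (x y : 'I_3 -> R) (p : R) :
  \int[P]_w cos (\sum_(i < 3) x i * tnth (Z w) i +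
                 \sum_(i < 3) y i * tnth (Yu w) i + p) =
  cos p * expR (- ((QZ x + QY y) / 2)).
Proof.
rewrite /QZ /QY -levy_variance_split// -(cos_levy_comb P W hW s r u)//.
by apply: eq_Rintegral => w _; rewrite levy_comb_split.
Qed.

Let QY0 : QY (fun=> 0) = 0.
Proof.
by rewrite /QY /increment_form /levy_variance expr0n /= !mul0r !addr0 mulr0.
Qed.

Let QZ0 : QZ (fun=> 0) = 0.
Proof.
by rewrite /QZ /mx_form big1// => i _; rewrite big1// => j _; rewrite !mul0r.
Qed.

(** At y = 0 the splitting identity displays the form of Sigma as a sum of variances over [s, r] and
    [r, u]. *)
Let QZ_ge0 x : 0 <= QZ x.
Proof.
suff : 0 <= QZ x + QY (fun=> 0) by rewrite QY0 addr0.
rewrite /QZ /QY -levy_variance_split//.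
by apply: addr_ge0; apply: mulr_ge0; rewrite ?subr_ge0//; exact: levy_variance_ge0.
Qed.

Let QY_ge0 y : 0 <= QY y.
Proof.
apply: mulr_ge0; last exact: levy_variance_ge0.
by rewrite subr_ge0 ltW.
Qed.

Let sum0 (v : 3.-tuple R) : \sum_(i < 3) 0 * tnth v i = 0.
Proof. by rewrite big1// => i _; rewrite mul0r. Qed.

Let cosZ x p : \int[P]_w cos (\sum_(i < 3) x i * tnth (Z w) i + p) =
  cos p * expR (- (QZ x / 2)).
Proof.
have := cos_residual x (fun=> 0) p; rewrite QY0 addr0 => <-.
by apply: eq_Rintegral => w _; rewrite sum0 addr0.
Qed.

Let cosY y p : \int[P]_w cos (\sum_(i < 3) y i * tnth (Yu w) i + p) =
  cos p * expR (- (QY y / 2)).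
Proof.
have := cos_residual (fun=> 0) y p; rewrite QZ0 add0r => <-.
by apply: eq_Rintegral => w _; rewrite sum0 add0r.
Qed.

Let mlin (V : T -> 3.-tuple R) (x : 'I_3 -> R) : measurable_fun [set: T] V ->
  measurable_fun [set: T] (fun w => \sum_(i < 3) x i * tnth (V w) i).
Proof.
move=> mV; apply: measurable_sum => i; apply: measurable_funM => //.
exact: mtnth.
Qed.

(** The product of cosines is half the sum of two joint transforms, at (x, y) and (x, - y). Both
    have the same exponential because [QY] is even, and it factors because the joint form has no
    cross term. *)
Let ZYindep A B : measurable A -> measurable B ->
  P (Z @^-1` A `&` Yu @^-1` B) = (P (Z @^-1` A) * P (Yu @^-1` B))%E.
Proof.
apply: independent_of_cos => // x y p q.
have bc (V : T -> R) : measurable_fun [set: T] V ->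
    bounded_measurable (fun w => cos (V w)) by exact: bounded_measurable_cos.
transitivity (\int[P]_w (2^-1 *
   (cos (\sum_(i < 3) x i * tnth (Z w) i +
         \sum_(i < 3) y i * tnth (Yu w) i + (p + q)) +
    cos (\sum_(i < 3) x i * tnth (Z w) i +
         \sum_(i < 3) (- y i) * tnth (Yu w) i + (p - q))))).
  apply: eq_Rintegral => w _.
  have -> : \sum_(i < 3) (- y i) * tnth (Yu w) i =
      - \sum_(i < 3) y i * tnth (Yu w) i.
    by rewrite -sumrN; apply: eq_bigr => i _; rewrite mulNr.
  set X1 := \sum_(i < 3) x i * _; set X2 := \sum_(i < 3) y i * _.
  have -> : X1 + X2 + (p + q) = (X1 + p) + (X2 + q) by ring.
  have -> : X1 - X2 + (p - q) = (X1 + p) - (X2 + q) by ring.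
  by move: (X1 + p) (X2 + q) => {}X1 {}X2; rewrite cosD cosB; field.
have b1 := bc _ (measurable_funD (measurable_funD (mlin _ x mZ) (mlin _ y mYu))
  (measurable_cst (p + q))).
have b2 := bc _ (measurable_funD (measurable_funD (mlin _ x mZ)
  (mlin _ (fun i => - y i) mYu)) (measurable_cst (p - q))).
rewrite (bounded_RintegralZl P _ _ (bounded_measurableD _ _ b1 b2)).
rewrite (bounded_RintegralD P _ _ b1 b2) !cos_residual cosZ cosY.
have -> : QY (fun i => - y i) = QY y.
  by rewrite /QY /increment_form /levy_variance !sqrrN.
have -> : expR (- ((QZ x + QY y) / 2)) =
    expR (- (QZ x / 2)) * expR (- (QY y / 2)).
  by rewrite -expRD; congr expR; ring.
by rewrite cosD cosB; field.
Qed.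

(** Replacing x by t x scales the form by t^2, so x . Z has the one-dimensional transform of
    variance [QZ x]. *)
Let momentsZ x : [/\ P.-integrable [set: T]
    (EFin \o (fun w => \sum_(i < 3) x i * tnth (Z w) i)),
  P.-integrable [set: T]
    (EFin \o (fun w => (\sum_(i < 3) x i * tnth (Z w) i) ^+ 2)),
  \int[P]_w (\sum_(i < 3) x i * tnth (Z w) i) = 0 &
  \int[P]_w ((\sum_(i < 3) x i * tnth (Z w) i) ^+ 2) = QZ x].
Proof.
have mx := mlin _ x mZ.
have hc t p : \int[P]_w cos (t * (\sum_(i < 3) x i * tnth (Z w) i) + p) =
    cos p * expR (- (QZ x * t ^+ 2 / 2)).
  have := cosZ (fun i => t * x i) p; rewrite /QZ mx_formZ (mulrC _ (t ^+ 2)) => <-.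
  apply: eq_Rintegral => w _; congr (cos (_ + _)).
  by rewrite mulr_sumr; apply: eq_bigr => i _; rewrite mulrA.
have h2 := sqr_integrable P _ _ mx hc (QZ_ge0 x).
by have [] := moments_of_cos P _ _ mx hc (QZ_ge0 x).
Qed.

Let momentsY y : P.-integrable [set: T]
  (EFin \o (fun w => \sum_(i < 3) y i * tnth (Yu w) i)).
Proof.
have my := mlin _ y mYu.
have hc t p : \int[P]_w cos (t * (\sum_(i < 3) y i * tnth (Yu w) i) + p) =
    cos p * expR (- (QY y * t ^+ 2 / 2)).
  have := cosY (fun i => t * y i) p.
  have -> : QY (fun i => t * y i) = QY y * t ^+ 2.
    by rewrite /QY /increment_form /levy_variance; ring.
  move=> <-; apply: eq_Rintegral => w _; congr (cos (_ + _)).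
  by rewrite mulr_sumr; apply: eq_bigr => i _; rewrite mulrA.
by have [] := moments_of_cos P _ _ my hc (QY_ge0 y).
Qed.

Let sum_delta (i : 'I_3) (F : 'I_3 -> R) :
  \sum_(k < 3) (k == i)%:R * F k = F i.
Proof.
rewrite (bigD1 i)//= eqxx mul1r big1 ?addr0// => k /negbTE ->.
by rewrite mul0r.
Qed.

Let integrableZ i : P.-integrable [set: T] (EFin \o (fun w => tnth (Z w) i)).
Proof.
have [+ _ _ _] := momentsZ (fun k => (k == i)%:R).
by congr (P.-integrable _ (EFin \o _)); apply/funext => w; exact: sum_delta.
Qed.

Let expectationZ i : \int[P]_w tnth (Z w) i = 0.
Proof.
have [_ _ <- _] := momentsZ (fun k => (k == i)%:R).
by apply: eq_Rintegral => w _; rewrite sum_delta.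
Qed.

Let covarianceZ i j :
  P.-integrable [set: T] (EFin \o (fun w => tnth (Z w) i * tnth (Z w) j)) /\
  \int[P]_w (tnth (Z w) i * tnth (Z w) j) = Sigma s r u i j.
Proof.
pose xp k : R := (k == i)%:R + (k == j)%:R.
pose xm k : R := (k == i)%:R - (k == j)%:R.
pose S x w := (\sum_(k < 3) x k * tnth (Z w) k) ^+ 2.
have [_ ip _ Ep] := momentsZ xp; have [_ im _ Em] := momentsZ xm.
have ZE w : tnth (Z w) i * tnth (Z w) j = 4^-1 * (S xp w - S xm w).
  have -> : S xp w = (tnth (Z w) i + tnth (Z w) j) ^+ 2.
    congr (_ ^+ 2); rewrite -[X in X + _]sum_delta -[X in _ + X]sum_delta.
    by rewrite -big_split; apply: eq_bigr => k _; rewrite /xp mulrDl.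
  have -> : S xm w = (tnth (Z w) i - tnth (Z w) j) ^+ 2.
    congr (_ ^+ 2); rewrite -[X in X - _]sum_delta -[X in _ - X]sum_delta.
    by rewrite -sumrB; apply: eq_bigr => k _; rewrite /xm mulrBl.
  by field.
have id : P.-integrable [set: T] (EFin \o (fun w => S xp w - S xm w)).
  exact: (integrableB measurableT ip im).
have -> : (fun w => tnth (Z w) i * tnth (Z w) j) =
    fun w => 4^-1 * (S xp w - S xm w) by apply/funext.
split; first exact: (integrableZl measurableT 4^-1 id).
rewrite RintegralZl// RintegralB// Ep Em mx_form_polarization.
  by field.
exact: Sigma_sym.
Qed.

Let integrableM i : P.-integrable [set: T]
  (EFin \o (fun w => tnth (mean_triple s r u (Yu w)) i)).
Proof.
have comb (c : 3.-tuple R) : P.-integrable [set: T]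
    (EFin \o (fun w => c`_0 * (Yu w)`_0 + c`_1 * (Yu w)`_1 + c`_2 * (Yu w)`_2)).
  have := momentsY (tnth c).
  congr (P.-integrable _ (EFin \o _)); apply/funext => w.
  by rewrite sum_ord3 !(tnth_nth 0).
move: i; apply: ord3_cases.
- exact: (comb [tuple (r - s) / (u - s);
    6 * ((r - s) * (u - r) / (u - s) ^+ 2);
    120 * ((r - s) * (u - r) * ((u + s) / 2 - r) / (u - s) ^+ 3)]).
- have := comb [tuple 0; (r - s) ^+ 2 / (u - s) ^+ 2;
    30 * ((r - s) ^+ 2 * (u - r) / (u - s) ^+ 3)].
  congr (P.-integrable _ (EFin \o _)); apply/funext => w.
  by rewrite [RHS]/= mul0r add0r.
- have := comb [tuple 0; 0; (r - s) ^+ 3 / (u - s) ^+ 3].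
  congr (P.-integrable _ (EFin \o _)); apply/funext => w.
  by rewrite [RHS]/= !mul0r !add0r.
Qed.

Definition residual_kernel : R.-pker (3.-tuple R) ~> (3.-tuple R) :=
  translated_kernel P Z (mean_triple s r u) mZ measurable_mean_triple.

Lemma residual_kernel_cond_distribution :
  cond_distribution P Yr Yu residual_kernel.
Proof.
apply: translated_kernel_cond_distribution => // w.
apply: eq_from_tnth => i; rewrite !tnth_mktuple.
by rewrite addrC subrK.
Qed.

Let integral_kernel y (f : 3.-tuple R -> R) c :
  measurable_fun [set: 3.-tuple R] f ->
  P.-integrable [set: T]
    (EFin \o (fun w => f (tuple_add (mean_triple s r u y) (Z w)))) ->
  \int[P]_w f (tuple_add (mean_triple s r u y) (Z w)) = c ->
  (residual_kernel y).-integrable [set: 3.-tuple R] (EFin \o f) /\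
  (\int[residual_kernel y]_x (f x)%:E = c%:E)%E.
Proof.
move=> mf fi <-.
have mT := measurable_translate Z (mean_triple s r u) mZ y.
have mEf : measurable_fun [set: 3.-tuple R] (EFin \o f) by exact/measurable_EFinP.
split; first exact: (integrable_law P _ mT _ mEf fi).
rewrite [LHS](integral_law P _ mT _ mEf fi) /Rintegral fineK//.
exact: (integrable_fin_num _ fi).
Qed.

Lemma residual_kernel_gaussian y :
  gaussian_law (residual_kernel y) (mean_triple s r u y) (Sigma s r u).
Proof.
have TE w i : tnth (tuple_add (mean_triple s r u y) (Z w)) i =
    tnth (mean_triple s r u y) i + tnth (Z w) i by exact: tnth_mktuple.
split.
- move=> a; pose m := \sum_(i < 3) a i * tnth (mean_triple s r u y) i.
  exists m, (Num.sqrt (QZ a)) => B mB.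
  pose V w := m + \sum_(i < 3) a i * tnth (Z w) i.
  have mV : measurable_fun [set: T] V by apply: measurable_funD => //; exact: mlin.
  have cosV t p : \int[P]_w cos (t * V w + p) =
      cos (t * m + p) * expR (- (Num.sqrt (QZ a) ^+ 2 * t ^+ 2 / 2)).
    rewrite sqr_sqrtr//; have := cosZ (fun i => t * a i) (t * m + p).
    rewrite /QZ mx_formZ (mulrC (t ^+ 2)) => <-.
    apply: eq_Rintegral => w _; congr cos.
    have -> : \sum_(i < 3) t * a i * tnth (Z w) i =
        t * \sum_(i < 3) a i * tnth (Z w) i.
      by rewrite mulr_sumr; apply: eq_bigr => i _; rewrite mulrA.
    by rewrite /V; ring.
  transitivity (P (V @^-1` B)).
    congr (P _); apply/seteqP.
    have VE w : \sum_(i < 3) a i *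
        tnth (tuple_add (mean_triple s r u y) (Z w)) i = V w.
      rewrite /V /m -big_split; apply: eq_bigr => i _.
      by rewrite TE mulrDr.
    by split => w /=; rewrite VE.
  (* Zero deviation does occur, for instance for every [a] when r = s or r = u; the target law is
     then the Dirac mass at [m]. *)
  rewrite /gaussian1; case: eqP => [v0|/eqP v0].
    apply: (law_unique_of_cos P V (@dirac _ (measurableTypeR R) m R)) => // t p.
    rewrite cosV v0 expr0n /= !mul0r oppr0 expR0 mulr1.
    rewrite /Rintegral integral_dirac//=; first by rewrite indicE in_setT mul1r.
    apply/measurable_EFinP; apply: (bounded_measurable_cos _ _).1.
    exact: measurable_funD.
  apply: (law_unique_of_cos P V (normal_prob m (Num.sqrt (QZ a)))) => // t p.
  by rewrite cosV Rintegral_cos_normal_prob.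
- move=> i; apply: integral_kernel; first exact: measurable_tnth.
    have := integrableD measurableT
      (bounded_measurable_integrable P _
        (bounded_measurable_cst (tnth (mean_triple s r u y) i))) (integrableZ i).
    congr (P.-integrable _ _); apply/funext => w.
    by rewrite /comp TE.
  transitivity (\int[P]_w (cst (tnth (mean_triple s r u y) i) w + tnth (Z w) i)).
    by apply: eq_Rintegral => w _; rewrite TE.
  rewrite RintegralD//; last first.
    exact/bounded_measurable_integrable/bounded_measurable_cst.
  have P1 : fine (P [set: T]) = 1 by rewrite probability_setT.
  by rewrite expectationZ Rintegral_cst// [fine _]P1 mulr1 addr0.
- move=> i j; have [ci cE] := covarianceZ i j.
  have E w : (tnth (tuple_add (mean_triple s r u y) (Z w)) i -
      tnth (mean_triple s r u y) i) *
     (tnth (tuple_add (mean_triple s r u y) (Z w)) j -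
      tnth (mean_triple s r u y) j) = tnth (Z w) i * tnth (Z w) j.
    by rewrite !TE; congr (_ * _); rewrite addrAC subrr add0r.
  apply: (integral_kernel y (fun x => (tnth x i - tnth (mean_triple s r u y) i) *
      (tnth x j - tnth (mean_triple s r u y) j))).
  + by apply: measurable_funM; apply: measurable_funB => //;
      exact: measurable_tnth.
  + by move: ci; congr (P.-integrable _ (EFin \o _)); apply/funext => w.
  + by rewrite -cE; apply: eq_Rintegral => w _; rewrite E.
Qed.

(** Y_{s,r} is the mean, a function of Y_{s,u}, plus an independent centred residual whose integral
    over any event of Y_{s,u} is 0. *)
Lemma cond_expectation_levy i :
  cond_expectation P Yu (fun w => tnth (Yr w) i)
    (fun w => tnth (mean_triple s r u (Yu w)) i).
Proof.
have YE w : tnth (Yr w) i = tnth (mean_triple s r u (Yu w)) i + tnth (Z w) i.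
  by rewrite tnth_mktuple addrC subrK.
have iY : P.-integrable [set: T] (EFin \o (fun w => tnth (Yr w) i)).
  have := integrableD measurableT (integrableM i) (integrableZ i).
  by congr (P.-integrable _ _); apply/funext => w; rewrite /comp YE.
split => //.
  move=> B mB; exists ((fun y => tnth (mean_triple s r u y) i) @^-1` B).
    rewrite -[X in measurable X]setTI.
    by have /measurable_fun_tnthP/(_ i) := measurable_mean_triple; exact.
  by rewrite setTI.
move=> A YA; have mA : measurable A.
  by case: YA => B mB <-; exact: mYu.
have iMA := integrableS measurableT mA (@subsetT _ A) (integrableM i).
have iZA := integrableS measurableT mA (@subsetT _ A) (integrableZ i).
under [RHS]eq_integral do rewrite YE EFinD.
rewrite integralD//.
rewrite (independent_integral_preimage P Z mZ Yu mYu ZYindep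
  (fun x => tnth x i) 0 A)//.
- by rewrite integral0 adde0.
- exact: measurable_tnth.
- exact: integrableZ.
Qed.

Lemma cond_expectation_levy_cov i j :
  cond_expectation P Yu
    (fun w => (tnth (Yr w) i - tnth (mean_triple s r u (Yu w)) i) *
              (tnth (Yr w) j - tnth (mean_triple s r u (Yu w)) j))
    (fun=> Sigma s r u i j).
Proof.
have [ci cE] := covarianceZ i j.
have ZE : (fun w => (tnth (Yr w) i - tnth (mean_triple s r u (Yu w)) i) *
    (tnth (Yr w) j - tnth (mean_triple s r u (Yu w)) j)) =
    fun w => tnth (Z w) i * tnth (Z w) j.
  by apply/funext => w; rewrite !tnth_mktuple.
rewrite ZE; split => //.
- exact/bounded_measurable_integrable/bounded_measurable_cst.
(* The candidate is constant, so its preimages are everything or nothing. *)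
- move=> B _; exists (if `[< B (Sigma s r u i j) >] then setT else set0).
    by case: ifP.
  rewrite setTI; case: ifPn => /asboolP BS.
    by apply/seteqP; split.
  by apply/seteqP; split.
- move=> A YA; apply/esym.
  apply: (independent_integral_preimage P Z mZ Yu mYu ZYindep
    (fun x => tnth x i * tnth x j)) => //.
  by apply: measurable_funM; exact: measurable_tnth.
Qed.

End Conditioning.

Theorem theorem3p7 (R : realType) (d : measure_display) (T : measurableType d)
    (P : probability T R) (W : R -> T -> R) (hW : standard_brownian P W)
    (s r u : R) (hs : 0 <= s) (hsu : s < u) (hsr : s <= r) (hru : r <= u) :
  let Yr := levy_triple W s r in
  let Yu := levy_triple W s u in
  let M := fun w => mean_triple s r u (Yu w) in
  [/\ exists k : R.-pker (3.-tuple R) ~> (3.-tuple R),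
        cond_distribution P Yr Yu k /\
        (forall y : 3.-tuple R,
           gaussian_law (k y) (mean_triple s r u y) (Sigma s r u)),
      forall i : 'I_3,
        cond_expectation P Yu (fun w => tnth (Yr w) i) (fun w => tnth (M w) i) &
      forall i j : 'I_3,
        cond_expectation P Yu
          (fun w => (tnth (Yr w) i - tnth (M w) i) *
                    (tnth (Yr w) j - tnth (M w) j))
          (fun=> Sigma s r u i j)].
Proof.
move=> Yr Yu M; split.
- exists (residual_kernel P W hW s r u hs hsu hsr); split.
    exact: residual_kernel_cond_distribution.
  exact: residual_kernel_gaussian.
- exact: cond_expectation_levy.
- exact: cond_expectation_levy_cov.
Qed.
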